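(* Let $\Omega \subset \mathbb{R}^N$, $N \geq 2$, be a bounded domain with $\partial\Omega$ of class $\mathcal{C}^2$, let $s \in (0,1)$ and let $\mu \in L^\infty(\Omega)$ be such that $\mu(x) \geq \mu_1 > 0$ in $\Omega$ for some constant $\mu_1$. Then, for all $1 \leq p < \frac{N}{2s}$, there exists $f \in L^p(\Omega)$ such that the Dirichlet problem $$(-\Delta)^s u = \mu(x)\, \mathbb{D}_s^2(u) + \lambda f(x) \ \text{ in } \Omega, \qquad u = 0 \ \text{ in } \mathbb{R}^N \setminus \Omega,$$ has no weak solutions in $W_0^{s,2}(\Omega)$ for any $\lambda > 0$.
   Context: With normalization constants omitted (set equal to $1$), $(-\Delta)^s u(x) = \mathrm{p.v.}\int_{\mathbb{R}^N} \frac{u(x)-u(y)}{|x-y|^{N+2s}}\,dy$ and $\mathbb{D}_s^2(u)(x) = \int_{\mathbb{R}^N} \frac{|u(x)-u(y)|^2}{|x-y|^{N+2s}}\,dy$. Weak solution: $u$ is a weak solution if $u$ and $\mathbb{D}_s^2(u)$ belong to $L^1(\Omega)$, $u \equiv 0$ in $\mathbb{R}^N\setminus\Omega$, and $\int_\Omega u\,(-\Delta)^s\phi\,dx = \int_\Omega \big(\mu(x)\mathbb{D}_s^2(u) + \lambda f(x)\big)\phi\,dx$ for all $\phi \in \mathbb{X}_s$, where $\mathbb{X}_s$ is the set of $\xi \in \mathcal{C}(\mathbb{R}^N)$ with $\operatorname{Supp}\xi \subset \overline{\Omega}$ such that $(-\Delta)^s\xi(x)$ exists for all $x \in \Omega$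 and $|(-\Delta)^s \xi(x)| \leq C$ on $\Omega$ for some $C>0$. $W_0^{s,p}(\Omega) := \{u \in W^{s,p}(\mathbb{R}^N) : u = 0 \text{ in } \mathbb{R}^N\setminus\Omega\}$, where $W^{s,p}(\mathbb{R}^N)$ is the set of $u\in L^p(\mathbb{R}^N)$ with $\iint_{\mathbb{R}^{2N}}\frac{|u(x)-u(y)|^p}{|x-y|^{N+sp}}\,dx\,dy<\infty$. *)

(* Defs.v *)
From HB Require Import structures.
From mathcomp Require Import all_boot all_order all_algebra.
From mathcomp Require Import all_classical all_reals all_analysis.

Set Implicit Arguments.
Unset Strict Implicit.
Unset Printing Implicit Defensive.

Import Order.TTheory GRing.Theory Num.Theory.
Import numFieldNormedType.Exports.

Local Open Scope classical_set_scope.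
Local Open Scope ring_scope.

(* The sigma-algebra on 'rV[R]_n is the one generated by the coordinates, as
   MathComp-Analysis does for n.-tuple; it is the Borel sigma-algebra. *)
Section measurable_rV.
Context (R : realType) (n : nat).

Definition rV_coord (i : 'I_n) (x : 'rV[R]_n) : measurableTypeR R := x 0 i.

Definition rV_display : measure_display -> measure_display.
Proof. exact. Qed.

Let rV_set0 : g_sigma_preimage rV_coord set0.
Proof. exact: sigma_algebra0. Qed.

Let rV_setC A : g_sigma_preimage rV_coord A -> g_sigma_preimage rV_coord (~` A).
Proof. exact: sigma_algebraC. Qed.

Let rV_bigcup (F : _^nat) : (forall i, g_sigma_preimage rV_coord (F i)) ->
  g_sigma_preimage rV_coord (\bigcup_i (F i)).
Proof. exact: sigma_algebra_bigcup. Qed.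

HB.instance Definition _ := @isMeasurable.Build (rV_display default_measure_display)
  'rV[R]_n (g_sigma_preimage rV_coord) rV_set0 rV_setC rV_bigcup.

Lemma measurable_rV_coord (i : 'I_n) : measurable_fun setT (rV_coord i).
Proof.
move=> _ Y mY; rewrite setTI; apply: sub_sigma_algebra => /=.
rewrite -bigcup_seq/=; exists i => /=; first by rewrite mem_index_enum.
by exists Y => //; rewrite setTI.
Qed.

Lemma measurable_fun_rV d (T : measurableType d) (f : T -> 'rV[R]_n) :
  (forall i, measurable_fun setT (rV_coord i \o f)) -> measurable_fun setT f.
Proof.
move=> mf _ A mA; rewrite setTI.
have : <<s \big[setU/set0]_(i < n)
    preimage_set_system setT (rV_coord i) measurable >> A by [].
suff : <<s \big[setU/set0]_(i < n)
    preimage_set_system setT (rV_coord i) measurable >> `<=`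
    [set B | measurable (f @^-1` B)] by move=> /[apply].
apply: smallest_sub.
  split => /=.
  - by rewrite preimage_set0.
  - by move=> B mB; rewrite setTD preimage_setC; exact: measurableC.
  - by move=> F mF; rewrite preimage_bigcup; exact: bigcupT_measurable.
rewrite -bigcup_seq => B [i _ [C mC <-]] /=.
by rewrite setTI -comp_preimage -[X in measurable X]setTI; exact: mf.
Qed.

End measurable_rV.

Section lebesgue_rV.
Context (R : realType).

Definition cons_rV n (z : measurableTypeR R * 'rV[R]_n) : 'rV[R]_n.+1 :=
  \row_(i < n.+1) if unlift ord0 i is Some j then z.2 0 j else z.1.

Definition uncons_rV n (x : 'rV[R]_n.+1) : measurableTypeR R * 'rV[R]_n :=
  (x 0 ord0, \row_(j < n) x 0 (lift ord0 j)).

Lemma cons_rVK n : cancel (@cons_rV n) (@uncons_rV n).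
Proof.
move=> [a x]; rewrite /uncons_rV mxE unlift_none; congr pair.
by apply/rowP => j; rewrite !mxE liftK.
Qed.

Lemma uncons_rVK n : cancel (@uncons_rV n) (@cons_rV n).
Proof.
move=> x; apply/rowP => i; rewrite mxE.
by case: unliftP => [j|] -> //=; rewrite mxE.
Qed.

Lemma measurable_cons_rV n : measurable_fun setT (@cons_rV n).
Proof.
apply: measurable_fun_rV => i.
case: (unliftP ord0 i) => [j|] ->.
- rewrite (_ : _ \o _ = rV_coord j \o snd); last first.
    by apply/funext => z; rewrite /rV_coord /= mxE liftK.
  by apply: measurableT_comp; [exact: measurable_rV_coord|exact: measurable_snd].
- rewrite (_ : _ \o _ = fst); first exact: measurable_fst.
  by apply/funext => z; rewrite /rV_coord /= mxE unlift_none.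
Qed.

Lemma measurable_uncons_rV n : measurable_fun setT (@uncons_rV n).
Proof.
apply/measurable_fun_pairP; split; first exact: measurable_rV_coord.
apply: measurable_fun_rV => i.
rewrite (_ : _ \o _ = rV_coord (lift ord0 i)); first exact: measurable_rV_coord.
by apply/funext => z; rewrite /rV_coord /= mxE.
Qed.

Section step.
Context (n : nat) (m : {sigma_finite_measure set 'rV[R]_n -> \bar R}).

Definition lebesgue_rV_step : set 'rV[R]_n.+1 -> \bar R :=
  pushforward (lebesgue_measure \x m)%E (@cons_rV n).

Let mpre A : measurable A -> measurable (@cons_rV n @^-1` A).
Proof.
by move=> mA; rewrite -[X in measurable X]setTI; exact: measurable_cons_rV.
Qed.

Let step0 : lebesgue_rV_step set0 = 0%E.
Proof. by rewrite /lebesgue_rV_step /pushforward preimage_set0 measure0. Qed.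

Let step_ge0 A : (0 <= lebesgue_rV_step A)%E.
Proof. by rewrite /lebesgue_rV_step /pushforward measure_ge0. Qed.

Let step_sigma_additive : semi_sigma_additive lebesgue_rV_step.
Proof.
move=> F mF tF mUF; rewrite /lebesgue_rV_step /pushforward preimage_bigcup.
apply: measure_semi_sigma_additive.
- by move=> i; exact: mpre.
- apply/trivIsetP => /= i j _ _ ij; rewrite -preimage_setI.
  by move/trivIsetP : tF => /(_ _ _ _ _ ij) ->//; rewrite preimage_set0.
- by rewrite -preimage_bigcup; exact: mpre.
Qed.

HB.instance Definition _ := isMeasure.Build _ _ _ lebesgue_rV_step
  step0 step_ge0 step_sigma_additive.

Let step_sigma_finite : sigma_finite setT lebesgue_rV_step.
Proof.
have /sigma_finiteP[F [TF ndF Foo]] := sigma_finiteT (@lebesgue_measure R).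
have /sigma_finiteP[G [TG ndG Goo]] := sigma_finiteT m.
exists (fun k => @uncons_rV n @^-1` (F k `*` G k)).
  rewrite -preimage_bigcup -(preimage_setT (@uncons_rV n)); congr (_ @^-1` _).
  rewrite -setXTT TF TG predeqE => -[x y]; split.
    move=> [/= [k _ Fkx] [l _ Gly]]; exists (maxn k l) => //; split.
    - by move: x Fkx; exact/subsetPset/ndF/leq_maxl.
    - by move: y Gly; exact/subsetPset/ndG/leq_maxr.
  by move=> [k _ []/= ? ?]; split; exists k.
move=> k; have [mF Fk] := Foo k; have [mG Gk] := Goo k; split.
  rewrite -[X in measurable X]setTI; apply: measurable_uncons_rV => //.
  exact: measurableX.
rewrite /lebesgue_rV_step /pushforward -comp_preimage.
rewrite (_ : _ \o _ = id); last by apply/funext => z; exact: cons_rVK.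
by rewrite preimage_id product_measure1E// lte_mul_pinfty// ge0_fin_numE.
Qed.

HB.instance Definition _ := Measure_isSigmaFinite.Build _ _ _ lebesgue_rV_step
  step_sigma_finite.

End step.

(* N-dimensional Lebesgue measure, as the N-fold product of the
   one-dimensional one. *)
Fixpoint lebesgue_rV (n : nat) : {sigma_finite_measure set 'rV[R]_n -> \bar R} :=
  if n is n'.+1 then lebesgue_rV_step (lebesgue_rV n') else \d_(0 : 'rV[R]_0).

End lebesgue_rV.

Section euclidean.
Context (R : realType).

(* `|x| on 'rV[R]_n is the sup norm, so the Euclidean norm is defined here. *)
Definition enorm n (x : 'rV[R]_n) : R := Num.sqrt (\sum_i x 0 i ^+ 2).

Definition eball n (x : 'rV[R]_n) (r : R) : set 'rV[R]_n :=
  [set y | enorm (y - x) < r].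

Definition partial n (i : 'I_n) (g : 'rV[R]_n -> R) : 'rV[R]_n -> R :=
  'D_(delta_mx 0 i) g.

Fixpoint is_Ck n (k : nat) (g : 'rV[R]_n -> R) : Prop :=
  continuous g /\
  if k is k'.+1 then
    forall i, (forall x, derivable g x (delta_mx 0 i)) /\ is_Ck k' (partial i g)
  else True.

Definition is_domain n (Omega : set 'rV[R]_n) : Prop :=
  [/\ open Omega, connected Omega & Omega !=set0].

Definition boundary n (Omega : set 'rV[R]_n) : set 'rV[R]_n :=
  closure Omega `\` Omega°.

(* Near each boundary point, in coordinates x *m Q obtained by an orthogonal
   change of axes, Omega is the set lying above the graph of a C^k function of
   the other n.-1 coordinates. *)
Definition Ck_boundary n (k : nat) (Omega : set 'rV[R]_n) : Prop :=
  forall x0, boundary Omega x0 ->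
  exists (r : R) (Q : 'M[R]_n) (i : 'I_n) (g : 'rV[R]_n.-1 -> R),
    [/\ 0 < r, Q *m Q^T = 1%:M, is_Ck k g &
      Omega `&` eball x0 r =
      [set x | g (col' i (x *m Q)) < (x *m Q) 0 i] `&` eball x0 r].

End euclidean.

Section fractional.
Context (R : realType) (N : nat).
Implicit Types (Omega : set 'rV[R]_N) (s p : R) (u xi : 'rV[R]_N -> R).

Local Notation leb := (lebesgue_rV R N).

Definition Lp_on Omega (p : \bar R) (f : 'rV[R]_N -> R) : Prop :=
  f \_ Omega \in Lfun leb p.

Definition frac_lap_quotient s u (x y : 'rV[R]_N) : R :=
  (u x - u y) / enorm (x - y) `^ (N%:R + 2 * s).

Definition frac_lap_trunc s u x (e : R) : R :=
  \int[leb]_(y in [set y | e < enorm (x - y)]) frac_lap_quotient s u x y.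

Definition frac_lap_exists s u x : Prop :=
  (forall e : R, 0 < e ->
     leb.-integrable [set y | e < enorm (x - y)]
       (EFin \o frac_lap_quotient s u x)) /\
  cvg (frac_lap_trunc s u x e @[e --> 0^'+]).

(* The principal value; meaningful only when [frac_lap_exists s u x] holds. *)
Definition frac_lap s u x : R := lim (frac_lap_trunc s u x e @[e --> 0^'+]).

Definition Ds2 s u (x : 'rV[R]_N) : \bar R :=
  (\int[leb]_y (`|u x - u y| ^+ 2 / enorm (x - y) `^ (N%:R + 2 * s))%:E)%E.

Definition gagliardo s p u : \bar R :=
  (\int[leb \x leb]_z
     (`|u z.1 - u z.2| `^ p / enorm (z.1 - z.2) `^ (N%:R + s * p))%:E)%E.

Definition Wsp s p u : Prop := u \in Lfun leb p%:E /\ (gagliardo s p u < +oo)%E.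

(* Elements of W^{s,p} are classes modulo a.e. equality, so they vanish outside
   Omega in the a.e. sense; likewise in [weak_solution]. *)
Definition W0sp Omega s p u : Prop :=
  Wsp s p u /\ {ae leb, forall x, ~ Omega x -> u x = 0}.

Definition Xs Omega s xi : Prop :=
  [/\ continuous xi,
      closure [set x | xi x != 0] `<=` closure Omega,
      forall x, Omega x -> frac_lap_exists s xi x &
      exists2 C : R, 0 < C & forall x, Omega x -> `|frac_lap s xi x| <= C].

Definition weak_solution Omega s (mu : 'rV[R]_N -> R) (lambda : R)
    (f u : 'rV[R]_N -> R) : Prop :=
  [/\ measurable_fun setT u,
      leb.-integrable Omega (EFin \o u),
      leb.-integrable Omega (Ds2 s u),
      {ae leb, forall x, ~ Omega x -> u x = 0} &
      forall phi, Xs Omega s phi ->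
        (\int[leb]_(x in Omega) (u x * frac_lap s phi x)%:E =
         \int[leb]_(x in Omega)
           (((mu x)%:E * Ds2 s u x + (lambda * f x)%:E) * (phi x)%:E))%E].

End fractional.

(* Main.v *)
(* Testing the equation with phi ^ 2, where phi >= 0 is Lipschitz and compactly
   supported, and symmetrizing the double integral gives
     \int u (-Delta)^s (phi ^ 2) =
       1/2 \iint (u x - u y) (phi x - phi y) (phi x + phi y) |x - y|^-(N + 2 s),
   which by AM-GM is at most
     mu1 \int phi ^ 2 D_s^2 u
       + (4 mu1)^-1 \iint (phi x - phi y) ^ 2 |x - y|^-(N + 2 s).
   The first term is absorbed by the right-hand side,
   so that lambda \int f phi ^ 2 is bounded by the energy of phi alone.  For the
   cutoff phi at scale r around an interior point x0 this energy is O(r ^ (N - 2 s)),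
   whereas \int f phi ^ 2 >= c r ^ (N - q) when f = |x - x0| ^ - q; as r -> 0 this is
   absurd as soon as q > 2 s, and q < N / p keeps f in L^p. *)
Require Import Defs.
From HB Require Import structures.
From mathcomp Require Import all_boot all_order all_algebra.
From mathcomp Require Import all_classical all_reals all_analysis.
From mathcomp Require Import measurable_realfun ring lra.

Set Implicit Arguments.
Unset Strict Implicit.
Unset Printing Implicit Defensive.

Import Order.TTheory GRing.Theory Num.Theory.
Import numFieldNormedType.Exports.

Local Open Scope classical_set_scope.
Local Open Scope ring_scope.

(** * Cubes, Borel sets and reflections *)

(** The kernel is therefore truncated at distance e, where Fubini applies; the bound obtained is
    free of e, and e tends to 0 only afterwards. That limit needs a bound on the truncated
    fractional Laplacian of phi ^ 2 that is uniform in e and in x in Omega. Averaging over the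
    reflection y -> 2 x - y turns first differences into second differences; this calls for a
    measure invariant under reflections and for a test function whose second differences are of
    order |x - y| ^ 2. The positive part of a paraboloid is only Lipschitz, but its square is
    C^{1,1}. The square also fits AM-GM, which leaves the weight phi ^ 2 on D_s^2 u; this term can
    be subtracted from both sides because D_s^2 u is integrable on Omega. Upper bounds use the sup
    norm, which is at most the Euclidean one: its balls are cubes, whose volume in a product measure
    is explicit. *)

Section rV_topology.
Context (R : realType) (n : nat).
Implicit Types (x y : 'rV[R]_n) (r : R).

Lemma rV_norm_leP x r : 0 <= r -> reflect (forall i, `|x 0 i| <= r) (`|x| <= r).
Proof.
move=> r0; rewrite (_ : `|x| = mx_norm x)// mx_normrE; apply: (iffP idP).
  by move=> /bigmax_leP[_ h] i; exact: (h (0, i)).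
by move=> h; apply/bigmax_leP; split => // -[i j] _ /=; rewrite (ord1 i).
Qed.

Lemma rV_coord_le_norm x i : `|x 0 i| <= `|x|.
Proof. exact: (rV_norm_leP x (normr_ge0 x) (lexx _)). Qed.

Definition cube x r : set 'rV[R]_n := [set y | `|x - y| <= r].

Lemma cubeE x r : 0 <= r ->
  cube x r = \big[setI/setT]_(i < n) (rV_coord i @^-1` `[x 0 i - r, x 0 i + r]).
Proof.
move=> r0; rewrite -bigcap_seq; apply/seteqP; split => y /=.
  move=> /(rV_norm_leP _ r0) xy i _ /=; have := xy i.
  by rewrite !mxE ler_norml in_itv /rV_coord /=; lra.
move=> xy; apply/rV_norm_leP => // i; have := xy i (mem_index_enum i).
by rewrite /= !mxE ler_norml in_itv /rV_coord /=; lra.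
Qed.

Lemma measurable_cube x r : 0 <= r -> measurable (cube x r).
Proof.
move=> r0; rewrite cubeE//; apply: bigsetI_measurable => i _.
rewrite -[X in measurable X]setTI; apply: measurable_rV_coord => //.
Qed.

(** Countably many cubes, with rational centres and radii [k.+1%:R^-1], exhaust an open set, so the
    sigma-algebra generated by the coordinates contains the open sets. *)
Lemma open_measurable_rV (A : set 'rV[R]_n) : open A -> measurable A.
Proof.
move=> oA.
pose q (c : 'rV[rat]_n) : 'rV[R]_n := map_mx ratr c.
pose F (i : 'rV[rat]_n * nat) : set 'rV[R]_n :=
  if `[< cube (q i.1) i.2.+1%:R^-1 `<=` A >]
  then cube (q i.1) i.2.+1%:R^-1 else set0.
have -> : A = \bigcup_i F i.
  apply/seteqP; split => [x Ax|x [i _]]; last first.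
    by rewrite /F; case: asboolP => // iA; exact: iA.
  have [e /= e0 eA] : nbhs_ball x A by apply/nbhs_ballP; exact: open_nbhs_nbhs.
  have [k ke] : exists k : nat, k.+1%:R^-1 < e / 2 :> R.
    have e20 : 0 < e / 2 by rewrite divr_gt0.
    by have [k] := ltr_add_invr e20; rewrite add0r => h; exists k.
  pose d : R := k.+1%:R^-1.
  have d0 : 0 < d by rewrite invr_gt0.
  have /choice[c cx] : forall i : 'I_n, exists c : rat, `|ratr c - x 0 i| <= d.
    move=> i; have /rat_in_itvoo[c] : x 0 i - d < x 0 i + d by lra.
    rewrite in_itv /= => /andP[? ?]; exists c.
    by rewrite ler_norml; lra.
  have qx : `|q (\row_i c i) - x| <= d.
    by apply/rV_norm_leP => [|i]; [exact: ltW|rewrite !mxE].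
  exists (\row_i c i, k) => //; rewrite /F /=; case: asboolP => //= -[] y yc.
  apply: eA; rewrite -ball_normE /=.
  rewrite (_ : x - y = - (q (\row_i c i) - x) + (q (\row_i c i) - y)); last first.
    by rewrite opprB addrA subrK.
  rewrite (le_lt_trans (ler_normD _ _))// normrN.
  by move: yc; rewrite /cube /= -/d => yc; rewrite -/d in ke; lra.
apply: countable_bigcupT_measurable; first exact: countableP.
move=> i; rewrite /F; case: asboolP => [_|_]; [exact: measurable_cube|exact: measurable0].
Qed.

Lemma continuous_measurable_rV (f : 'rV[R]_n -> R) :
  continuous f -> measurable_fun setT f.
Proof.
move=> /continuousP cf; apply: (measurability (RGenOpens.G (R:=R))).
  exact: RGenOpens.measurableE.
move=> _ [_ [a [b ->]] <-]; rewrite setTI; apply: open_measurable_rV; apply: cf.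
exact: interval_open.
Qed.

End rV_topology.

(** * Volume of cubes and invariance of the measure under reflections *)

Section lebesgue_rV_theory.
Context (R : realType).

Lemma lebesgue_cube n (x : 'rV[R]_n) (r : R) : 0 <= r ->
  lebesgue_rV R n (cube x r) = ((2 * r) ^+ n)%:E.
Proof.
move=> r0; elim: n x => [|n IH] x.
  rewrite expr0 /=.
  rewrite diracE mem_set//= /cube /=.
  by apply/rV_norm_leP => // -[].
rewrite /= /lebesgue_rV_step /pushforward.
rewrite (_ : _ @^-1` _ = `[x 0 ord0 - r, x 0 ord0 + r] `*` cube (uncons_rV x).2 r); last first.
  apply/seteqP; split => -[a y] /=.
    move=> /(rV_norm_leP _ r0) h; split.
      have := h ord0; rewrite !mxE unlift_none /= ler_norml in_itv /=; lra.
    by apply/rV_norm_leP => // i; have := h (lift ord0 i); rewrite !mxE liftK.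
  move=> [+ /(rV_norm_leP _ r0) h]; rewrite in_itv /= => h0.
  apply/(rV_norm_leP _ r0) => i; rewrite !mxE; case: unliftP => [j|] -> /=.
    by have := h j; rewrite !mxE.
  by rewrite ler_norml; lra.
rewrite product_measure1E//; last exact: measurable_cube.
rewrite [X in (_ * X)%E]IH /= lebesgue_measure_itv /= lte_fin.
rewrite exprS EFinM.
case: ltP => h; first by rewrite -EFinD; congr (_%:E * _)%E; lra.
have r00 : r = 0 by lra.
by rewrite r00 mulr0 !mul0e.
Qed.

Lemma measurable_refl_rV n (c : 'rV[R]_n) : measurable_fun setT (fun y : 'rV[R]_n => c - y).
Proof.
apply: measurable_fun_rV => i.
rewrite (_ : _ \o _ = (fun y => c 0 i - rV_coord i y)); last first.
  by apply/funext => y; rewrite /rV_coord /= !mxE.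
by apply: measurable_funB => //; exact: measurable_rV_coord.
Qed.

Lemma lebesgue_measure_refl (c : R) (A : set (measurableTypeR R)) : measurable A ->
  lebesgue_measure ((fun a : measurableTypeR R => c - a : measurableTypeR R) @^-1` A)
  = lebesgue_measure A.
Proof.
move=> mA.
have mf : measurable_fun setT (fun a : measurableTypeR R => c - a : measurableTypeR R).
  exact: measurable_funB.
rewrite -[LHS]/(pushforward lebesgue_measure
  (fun a : measurableTypeR R => c - a : measurableTypeR R) A).
apply/esym/lebesgue_measure_unique => //= _ [[a b]] _ <-.
(* The reflection moves the closed end of a half-open interval to the left; the measure does not see
   end points. *)
rewrite /pushforward (_ : _ @^-1` _ = `[c - b, c - a[%classic); last first.
  by apply/seteqP; split => y /=; rewrite !in_itv /=; lra.
rewrite !lebesgue_measure_itv/= !lte_fin.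
have -> : (c - b < c - a) = (a < b) by apply/idP/idP; lra.
by case: ifP => // _; rewrite -!EFinD; congr EFin; lra.
Qed.

(** Induction on the dimension: through [cons_rV] the reflection splits into one of the first
    coordinate and one of the others, and a product measure is determined by its values on
    rectangles. *)
Lemma lebesgue_refl n (c : 'rV[R]_n) (A : set 'rV[R]_n) : measurable A ->
  lebesgue_rV R n ((fun y => c - y) @^-1` A) = lebesgue_rV R n A.
Proof.
elim: n c A => [|n IH] c A mA.
  rewrite (_ : (fun y => c - y) @^-1` A = A)//.
  by apply/seteqP; split => y /=; rewrite !thinmx0.
pose phi (z : measurableTypeR R * 'rV[R]_n) : measurableTypeR R * 'rV[R]_n :=
  ((c 0 ord0 - z.1 : R) : measurableTypeR R, (uncons_rV c).2 - z.2).
have mphi : measurable_fun setT phi.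
  apply/measurable_fun_pairP; split.
    by apply: measurable_funB => //; exact: measurable_fst.
  rewrite (_ : _ \o _ = (fun y => (uncons_rV c).2 - y) \o snd)//.
  by apply: measurableT_comp; [exact: measurable_refl_rV|exact: measurable_snd].
have mB : measurable (@cons_rV R n @^-1` A).
  by rewrite -[X in measurable X]setTI; exact: measurable_cons_rV.
have step : @cons_rV R n @^-1` ((fun y => c - y) @^-1` A) =
    phi @^-1` (@cons_rV R n @^-1` A).
  apply/seteqP; split => -[a y] /=; (congr A; apply/rowP => i;
    rewrite !mxE; case: unliftP => [j|] -> //=; by rewrite !mxE).
rewrite /= /lebesgue_rV_step /pushforward step.
rewrite -[LHS]/(pushforward (lebesgue_measure \x lebesgue_rV R n)%E phi _).
apply/esym/(product_measure_unique _) => //= B C mB' mC.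
rewrite /pushforward (_ : phi @^-1` _ =
  ((fun a : measurableTypeR R => c 0 ord0 - a : measurableTypeR R) @^-1` B) `*`
  ((fun y => (uncons_rV c).2 - y) @^-1` C))//.
rewrite product_measure1E//.
- congr (_ * _)%E; [exact: lebesgue_measure_refl|exact: IH].
- by rewrite -[X in measurable X]setTI; apply: (measurable_funB (f:=cst _)).
- by rewrite -[X in measurable X]setTI; apply: measurable_refl_rV.
Qed.

End lebesgue_rV_theory.

(** * Integrals of powers of the distance *)

Section dyadic.
Context (R : realType) (n : nat).
Implicit Types (x y : 'rV[R]_n) (r a b : R).

Local Notation leb := (lebesgue_rV R n).

Lemma measurable_norm_sub x : measurable_fun setT (fun y : 'rV[R]_n => `|x - y|).
Proof.
rewrite (_ : (fun y => _) = Num.norm \o (fun y => x - y))//.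
apply: measurableT_comp; last exact: measurable_refl_rV.
by apply: continuous_measurable_rV; exact: norm_continuous.
Qed.

(* Stands in for polar coordinates: [g] is compared with a geometric series of
   indicators of concentric cubes. *)
Lemma dyadic_integral_le x (g : 'rV[R]_n -> R) (c rho : nat -> R) (A q : R) :
  measurable_fun setT g -> (forall y, 0 <= g y) ->
  (forall k, 0 <= c k) -> (forall k, 0 <= rho k) ->
  0 <= A -> 0 < q -> q < 1 ->
  (forall y, g y = 0 \/ exists k, `|x - y| <= rho k /\ g y <= c k) ->
  (forall k, c k * (2 * rho k) ^+ n = A * q ^+ k) ->
  (\int[leb]_y (g y)%:E <= (A / (1 - q))%:E)%E.
Proof.
move=> mg g0 c0 rho0 A0 q0 q1 gc cA.
pose F k y : \bar R := ((c k)%:E * (\1_(cube x (rho k)) y)%:E)%E.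
have F0 k y : (0 <= F k y)%E by rewrite mule_ge0// lee_fin.
have mF k : measurable_fun setT (F k).
  apply/measurable_EFinP; apply: measurable_funM => //.
  by apply: measurable_indic; exact: measurable_cube.
apply: (@le_trans _ _ (\int[leb]_y (\sum_(k <oo) F k y))%E).
  apply: ge0_le_integral => //.
  - by move=> y _; rewrite lee_fin.
  - exact/measurable_EFinP.
  - by apply: ge0_emeasurable_sum => //.
  - move=> y _; have [->|[k [yk gk]]] := gc y.
      by apply: nneseries_ge0 => k _ _; exact: F0.
    apply: (@le_trans _ _ (F k y)).
      by rewrite /F indicE mem_set// mule1 lee_fin.
    apply: le_trans (nneseries_lim_ge k.+1 _); last by move=> *; exact: F0.
    by rewrite big_nat_recr//= leeDr// sume_ge0.
rewrite integral_nneseries//.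
have intF k : (\int[leb]_y F k y = (A * q ^+ k)%:E)%E.
  rewrite /F ge0_integralZl//; last 2 first.
  - apply/measurable_EFinP; apply: measurable_indic; exact: measurable_cube.
  - by rewrite lee_fin.
  rewrite integral_indic//; last exact: measurable_cube.
  by rewrite setIT [X in (_ * X)%E]lebesgue_cube// -EFinM cA.
under eq_eseriesr do rewrite intF.
apply: lime_le.
  by apply: is_cvg_nneseries => k _ _; rewrite lee_fin mulr_ge0// exprn_ge0// ltW.
apply: nearW => m; rewrite sumEFin lee_fin.
by apply: geometric_le_lim => //; rewrite ger0_norm// ltW.
Qed.

Lemma powR_expnl (t : R) k a : 0 <= t -> (t ^+ k) `^ a = (t `^ a) ^+ k.
Proof.
move=> t0; rewrite -(powR_mulrn k t0) -(powR_mulrn k (powR_ge0 t a)).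
by rewrite -!powRrM [k%:R * a]mulrC.
Qed.

Lemma ler_powRN (t u a : R) : 0 <= a -> 0 < t -> t <= u -> u `^ (- a) <= t `^ (- a).
Proof.
move=> a0 t0 tu; rewrite !powRN lef_pV2 ?posrE ?powR_gt0//; last exact: lt_le_trans tu.
by rewrite ge0_ler_powR// nnegrE; [exact: ltW|rewrite ltW// (lt_le_trans t0)].
Qed.

Lemma integral_cube_powR a : 0 <= a -> a < n%:R ->
  exists2 C : R, 0 <= C & forall x r, 0 < r ->
    (\int[leb]_y (\1_(cube x r) y * `|x - y| `^ (- a))%:E <= (C * r `^ (n%:R - a))%:E)%E.
Proof.
move=> a0 an.
pose h : R := 2^-1.
have h0 : 0 < h by rewrite invr_gt0.
pose q := h `^ (n%:R - a).
have q0 : 0 < q by rewrite powR_gt0.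
have q1 : q < 1.
  have -> : 1 = 1 `^ (n%:R - a) :> R by rewrite powR1.
  rewrite /q gt0_ltr_powR ?subr_gt0 ?nnegrE//; first exact: ltW.
  by rewrite /h; lra.
exists (h `^ (- a) * 2 ^+ n / (1 - q)).
  by rewrite divr_ge0 ?subr_ge0 ?mulr_ge0 ?powR_ge0 ?exprn_ge0//; exact: ltW.
move=> x r r0.
rewrite [X in (_ <= X%:E)%E](_ : _ = (h `^ (- a) * 2 ^+ n * r `^ (n%:R - a)) / (1 - q)); last by ring.
(* On the shell r h^(k+1) < |x - y| <= r h^k the power is at most its value at the inner radius;
   this value times the volume of the outer cube is geometric of ratio [q], which is below 1 since a
   < n. *)
apply: (@dyadic_integral_le x _ (fun k => (r * h * h ^+ k) `^ (- a))
    (fun k => r * h ^+ k)) => //.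
- apply: measurable_funM; first by apply: measurable_indic; apply: measurable_cube; exact: ltW.
  apply: (measurableT_comp (measurable_powR _)); exact: measurable_norm_sub.
- by move=> k; rewrite powR_ge0.
- by move=> k; rewrite mulr_ge0 ?exprn_ge0// ltW.
- by rewrite !mulr_ge0 ?powR_ge0.
- move=> y; rewrite indicE.
  have [yr|] := boolP (y \in _); last by rewrite mul0r; left.
  move: yr; rewrite inE /cube /= mul1r => yr.
  (* At the centre the power of zero is 1 if [a = 0] and 0 otherwise; both values fit the
     comparison. *)
  have [y0|y0] := eqVneq `|x - y| 0.
    have [a00|a00] := eqVneq a 0.
      right; exists 0%N; rewrite expr0 mulr1 yr; split => //.
      by rewrite a00 oppr0 !powRr0.
    by left; rewrite y0 powR0// oppr_eq0.
  right; have {}y0 : 0 < `|x - y| by rewrite lt_def y0 normr_ge0.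
  have ex : exists k, r * h * h ^+ k < `|x - y|.
    exists (Num.bound (r * h / `|x - y|)).
    have := upper_nthrootP (leqnn (Num.bound (r * h / `|x - y|))).
    rewrite ltr_pdivrMr// /h exprVn => H.
    by rewrite ltr_pdivrMr ?exprn_gt0// [ltRHS]mulrC.
  (* The least [k] whose inner radius is below the distance: by minimality the outer radius is
     not. *)
  have [k kP kmin] := ex_minnP ex.
  exists k; split; last by rewrite ler_powRN// ?ltW// !mulr_gt0 ?exprn_gt0.
  case: k kP kmin => [|k] kP kmin; first by rewrite expr0 mulr1.
  rewrite leNgt; apply/negP => H; suff : (k.+1 <= k)%N by rewrite ltnn.
  by apply: kmin; rewrite -mulrA -exprS.
- move=> k.
  rewrite !powRM ?exprn_ge0// ?mulr_ge0// ?ltW// powR_expnl ?ltW//.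
  rewrite /q !exprMn powRD ?powRD; last 2 first.
    by apply/implyP => _; rewrite gt_eqF.
  by apply/implyP => _; rewrite gt_eqF.
  rewrite !powR_mulrn ?ltW// exprMn -!exprM [(k * n)%N]mulnC.
  by ring.
Qed.

Lemma integral_cubeC_powR b : n%:R < b ->
  exists2 C : R, 0 <= C & forall x r, 0 < r ->
    (\int[leb]_y (\1_(~` cube x r) y * `|x - y| `^ (- b))%:E <= (C * r `^ (n%:R - b))%:E)%E.
Proof.
move=> nb.
have b0 : 0 <= b by rewrite (le_trans _ (ltW nb)).
pose q : R := 2 `^ (n%:R - b).
have q0 : 0 < q by rewrite powR_gt0.
have q1 : q < 1.
  rewrite /q -opprB powRN invf_lt1 ?powR_gt0//.
  have one : 1 = 1 `^ (b - n%:R) :> R by rewrite powR1.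
  by rewrite [ltLHS]one gt0_ltr_powR ?subr_gt0 ?nnegrE//; lra.
exists (4 ^+ n / (1 - q)).
  by rewrite divr_ge0 ?subr_ge0 ?exprn_ge0//; exact: ltW.
move=> x r r0.
rewrite [X in (_ <= X%:E)%E](_ : _ = (4 ^+ n * r `^ (n%:R - b)) / (1 - q)); last by ring.
(* The shells r 2^k < |x - y| <= r 2^(k+1) now grow. In [4 ^+ n] one factor 2 is the ratio of side
   to radius of a cube, the other the ratio of outer to inner radius. *)
apply: (@dyadic_integral_le x _ (fun k => (r * 2 ^+ k) `^ (- b))
    (fun k => r * 2 * 2 ^+ k)) => //.
- apply: measurable_funM.
    by apply: measurable_indic; apply: measurableC; apply: measurable_cube; exact: ltW.
  apply: (measurableT_comp (measurable_powR _)); exact: measurable_norm_sub.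
- by move=> k; rewrite powR_ge0.
- by move=> k; rewrite mulr_ge0 ?exprn_ge0// mulr_ge0// ltW.
- by rewrite !mulr_ge0 ?powR_ge0.
- move=> y; rewrite indicE.
  have [yr|] := boolP (y \in _); last by rewrite mul0r; left.
  move: yr; rewrite inE /cube /= mul1r => /negP; rewrite -ltNge => yr; right.
  have y0 : 0 < `|x - y| by rewrite (lt_trans r0).
  have ex : exists k, `|x - y| <= r * 2 * 2 ^+ k.
    exists (Num.bound (`|x - y| / r)).
    have := upper_nthrootP (leqnn (Num.bound (`|x - y| / r))).
    rewrite ltr_pdivrMr// => /ltW H; rewrite (le_trans H)//.
    rewrite [leLHS]mulrC (ler_pM2r (exprn_gt0 _ _))//.
    by rewrite mulrDr mulr1 lerDl ltW.
  have [k kP kmin] := ex_minnP ex.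
  exists k; split => //; apply: ler_powRN => //; first by rewrite mulr_gt0 ?exprn_gt0.
  case: k kP kmin => [|k] kP kmin; first by rewrite expr0 mulr1 ltW.
  rewrite leNgt; apply/negP => H; suff : (k.+1 <= k)%N by rewrite ltnn.
  by apply: kmin; rewrite -mulrA -exprS ltW.
- move=> k.
  rewrite !powRM ?exprn_ge0// ?mulr_ge0// ?ltW// powR_expnl ?ltW//.
  rewrite /q !exprMn powRD ?powRD; last 2 first.
    by apply/implyP => _; rewrite gt_eqF.
  by apply/implyP => _; rewrite gt_eqF.
  rewrite !powR_mulrn ?ltW// exprMn -!exprM [(k * n)%N]mulnC.
  have -> : 4 = 2 * 2 :> R by ring.
  rewrite exprMn.
  by ring.
Qed.

End dyadic.

(** * The kernel and the cutoff function *)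

Section enorm_theory.
Context (R : realType) (n : nat).
Implicit Types (x y h : 'rV[R]_n) (s : R).

Lemma enormN h : enorm (- h) = enorm h.
Proof. by rewrite /enorm; under eq_bigr do rewrite mxE sqrrN. Qed.

Lemma enorm_ge0 h : 0 <= enorm h.
Proof. exact: sqrtr_ge0. Qed.

Lemma enorm0 : enorm (0 : 'rV[R]_n) = 0.
Proof. by rewrite /enorm big1 ?sqrtr0// => i _; rewrite mxE expr0n. Qed.

Lemma norm_le_enorm h : `|h| <= enorm h.
Proof.
apply/rV_norm_leP => [|i]; first exact: enorm_ge0.
rewrite -sqrtr_sqr ler_wsqrtr// (bigD1 i)//= lerDl.
by apply: sumr_ge0 => j _; exact: sqr_ge0.
Qed.

Lemma enorm_gt0 h : h != 0 -> 0 < enorm h.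
Proof. by move=> h0; rewrite (lt_le_trans _ (norm_le_enorm h))// normr_gt0. Qed.

Lemma measurable_enorm : measurable_fun setT (@enorm R n).
Proof.
apply: (measurableT_comp (measurable_realfun.continuous_measurable_fun (@sqrt_continuous R))).
apply: measurable_sum => i; apply: measurable_funX.
exact: measurable_rV_coord.
Qed.

Lemma measurable_sub_rV :
  measurable_fun setT (fun z : 'rV[R]_n * 'rV[R]_n => z.1 - z.2).
Proof.
apply: measurable_fun_rV => i.
rewrite (_ : _ \o _ = fun z : 'rV[R]_n * 'rV[R]_n => rV_coord i z.1 - rV_coord i z.2); last first.
  by apply/funext => y; rewrite /rV_coord /= !mxE.
apply: measurable_funB.
  by apply: measurableT_comp; [exact: measurable_rV_coord|exact: measurable_fst].
by apply: measurableT_comp; [exact: measurable_rV_coord|exact: measurable_snd].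
Qed.

(** For [0 < s] the power of zero makes the kernel vanish at the origin, so pointwise statements
    also hold on the diagonal. *)
Definition kern s h : R := enorm h `^ (- (n%:R + 2 * s)).

Lemma kernE s h : (enorm h `^ (n%:R + 2 * s))^-1 = kern s h.
Proof. by rewrite /kern powRN. Qed.

Lemma kern_ge0 s h : 0 <= kern s h.
Proof. exact: powR_ge0. Qed.

Lemma kernN s h : kern s (- h) = kern s h.
Proof. by rewrite /kern enormN. Qed.

Lemma measurable_kern s : measurable_fun setT (kern s).
Proof. by apply: (measurableT_comp (measurable_powR _)); exact: measurable_enorm. Qed.

Lemma kern_le s h : 0 < s -> kern s h <= `|h| `^ (- (n%:R + 2 * s)).
Proof.
move=> s0; have n0 : 0 <= n%:R :> R by [].
have [->|h0] := eqVneq h 0.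
  by rewrite /kern enorm0 normr0.
by rewrite ler_powRN// ?normr_gt0 ?norm_le_enorm//; lra.
Qed.

End enorm_theory.

(** * A cutoff with Lipschitz and second-difference bounds *)

Section cutoff.
Context (R : realType) (n : nat).
Implicit Types (x y h : 'rV[R]_n) (r : R).

Definition sqdist x y : R := \sum_i (x 0 i - y 0 i) ^+ 2.

(** Positive part of a paraboloid: the squared Euclidean distance is a polynomial with explicit
    second differences, and the support lies in the cube of radius [r]. *)
Definition cutoff x0 r x : R := Num.max (1 - sqdist x x0 / r ^+ 2) 0.

Lemma sum_ord_le (F : 'I_n -> R) (c : R) :
  (forall i, F i <= c) -> \sum_i F i <= n%:R * c.
Proof.
move=> Fc; apply: (@le_trans _ _ (\sum_(i < n) c)); first exact: ler_sum.
by rewrite sumr_const card_ord mulr_natl.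
Qed.

Lemma sqdist_ge0 x y : 0 <= sqdist x y.
Proof. by apply: sumr_ge0 => i _; exact: sqr_ge0. Qed.

Lemma sqdist_diff x0 x y :
  `|sqdist x x0 - sqdist y x0| <= n%:R * (`|x - y| * (`|x0 - x| + `|x0 - y|)).
Proof.
rewrite /sqdist -sumrB (le_trans (ler_norm_sum _ _ _))//.
apply: sum_ord_le => i.
have -> : (x 0 i - x0 0 i) ^+ 2 - (y 0 i - x0 0 i) ^+ 2 =
  - ((x - y) 0 i * ((x0 - x) 0 i + (x0 - y) 0 i)) by rewrite !mxE; ring.
rewrite normrN normrM ler_pM// ?rV_coord_le_norm//.
by rewrite (le_trans (ler_normD _ _))// lerD// rV_coord_le_norm.
Qed.

Lemma sqdist_second_diff x0 x y :
  `|sqdist y x0 + sqdist (x *+ 2 - y) x0 - 2 * sqdist x x0| <= 2 * n%:R * `|x - y| ^+ 2.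
Proof.
have -> : sqdist y x0 + sqdist (x *+ 2 - y) x0 - 2 * sqdist x x0 =
  \sum_i 2 * (x - y) 0 i ^+ 2.
  rewrite /sqdist -big_split mulr_sumr -sumrB /=; apply: eq_bigr => i _.
  by rewrite !mxE; ring.
rewrite ger0_norm; last by apply: sumr_ge0 => i _; rewrite mulr_ge0// sqr_ge0.
rewrite [2 * _]mulrC -mulrA; apply: sum_ord_le => i; rewrite ler_pM2l//.
by rewrite -real_normK ?num_real// lerXn2r ?nnegrE// rV_coord_le_norm.
Qed.

Lemma cutoff_ge0 x0 r x : 0 <= cutoff x0 r x.
Proof. by rewrite /cutoff le_max lexx orbT. Qed.

Lemma cutoff_le1 x0 r x : cutoff x0 r x <= 1.
Proof.
rewrite /cutoff ge_max ler01 andbT lerBlDr lerDl.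
by rewrite divr_ge0 ?sqdist_ge0 ?sqr_ge0.
Qed.

Lemma cutoff_neq0 x0 r x : 0 < r -> cutoff x0 r x != 0 -> `|x0 - x| <= r.
Proof.
move=> r0 c0; have {c0} : 0 < cutoff x0 r x by rewrite lt_def c0 cutoff_ge0.
rewrite /cutoff lt_max ltxx orbF subr_gt0 ltr_pdivrMr ?exprn_gt0// mul1r => H.
apply/rV_norm_leP => [|i]; first exact: ltW.
rewrite -(@ler_pXn2r _ 2) ?nnegrE ?(ltW r0)// real_normK ?num_real//.
apply: le_trans (ltW H); rewrite /sqdist (bigD1 i)//= !mxE -sqrrN opprB lerDl.
by apply: sumr_ge0 => j _; exact: sqr_ge0.
Qed.

(** In this smaller cube the squared Euclidean distance is at most n times the squared radius, that
    is [r ^+ 2 / (4 * n%:R)]. *)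
Lemma cutoff_ge_half x0 r x : (0 < n)%N -> 0 < r -> `|x0 - x| <= r / (2 * n%:R) ->
  2^-1 <= cutoff x0 r x.
Proof.
move=> n0 r0 xr; rewrite /cutoff le_max; apply/orP; left.
have n1 : 1 <= n%:R :> R by rewrite ler1n.
have : sqdist x x0 <= n%:R * (r / (2 * n%:R)) ^+ 2.
  apply: sum_ord_le => i; rewrite -[leLHS]real_normK ?num_real// lerXn2r ?nnegrE//.
    by rewrite divr_ge0// ?mulr_ge0 ?ltW.
  by rewrite distrC; have := rV_coord_le_norm (x0 - x) i; rewrite !mxE => /le_trans; exact.
have -> : n%:R * (r / (2 * n%:R)) ^+ 2 = r ^+ 2 / (4 * n%:R).
  by field; rewrite gt_eqF// (lt_le_trans ltr01).
move=> H; suff : sqdist x x0 / r ^+ 2 <= 2^-1 by lra.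
rewrite ler_pdivrMr ?exprn_gt0//; apply: le_trans H _.
rewrite mulrC ler_wpM2r ?sqr_ge0// lef_pV2 ?posrE ?mulr_gt0//; lra.
Qed.

Lemma max0_lip (a b : R) : `|Num.max a 0 - Num.max b 0| <= `|a - b|.
Proof.
rewrite /Order.max; case: ltP => ?; case: ltP => ?;
rewrite ler_norml ?opprB; case: (lerP a b) => ?; rewrite ?(ler0_norm, ger0_norm) //; lra.
Qed.

Lemma cutoff_dist_le1 x0 r x y : `|cutoff x0 r x - cutoff x0 r y| <= 1.
Proof.
have := (cutoff_ge0 x0 r x, cutoff_le1 x0 r x, cutoff_ge0 x0 r y, cutoff_le1 x0 r y).
by case=> -[[? ?] ?] ?; rewrite ler_norml; lra.
Qed.

Lemma cutoff_lip x0 r x y : (0 < n)%N -> 0 < r ->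
  `|cutoff x0 r x - cutoff x0 r y| <= 3 * n%:R * (`|x - y| / r).
Proof.
move=> n0 r0.
have n1 : 1 <= n%:R :> R by rewrite ler1n.
(* At distance at least [r] the trivial bound 1 suffices. Nearer, one of the points may be assumed
   in the support, so their distances to [x0] are at most r and 2 r; the sum 3 r is the origin of
   the constant. *)
have [rxy|xyr] := leP r `|x - y|.
  apply: le_trans (cutoff_dist_le1 x0 r x y) _.
  have : 1 <= `|x - y| / r by rewrite ler_pdivlMr// mul1r.
  by nra.
wlog cx : x y xyr / cutoff x0 r x != 0.
  move=> H; have [cx|] := eqVneq (cutoff x0 r x) 0; last exact: H.
  have [cy|cy] := eqVneq (cutoff x0 r y) 0.
    by rewrite cx cy subrr normr0 !mulr_ge0// ?invr_ge0 ?ltW.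
  by rewrite distrC [`|x - y|]distrC; apply: H => //; rewrite distrC.
have xr := cutoff_neq0 r0 cx.
have yr : `|x0 - y| <= 2 * r.
  have -> : x0 - y = (x0 - x) + (x - y) by rewrite addrA subrK.
  by rewrite (le_trans (ler_normD _ _))//; lra.
apply: (le_trans (max0_lip _ _)).
have -> : 1 - sqdist x x0 / r ^+ 2 - (1 - sqdist y x0 / r ^+ 2) =
  - ((sqdist x x0 - sqdist y x0) / r ^+ 2) by ring.
rewrite normrN normrM [`|_^-1|]ger0_norm ?invr_ge0 ?sqr_ge0//.
rewrite ler_pdivrMr ?exprn_gt0//; apply: le_trans (sqdist_diff x0 x y) _.
have -> : 3 * n%:R * (`|x - y| / r) * r ^+ 2 = n%:R * (`|x - y| * (3 * r)).
  by field; rewrite gt_eqF.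
by rewrite ler_wpM2l// ler_wpM2l//; lra.
Qed.

(** The squared positive part of 1 - t is convex with derivative [- 2 * Num.max (1 - t) 0], which is
    2-Lipschitz: this bounds its first-order Taylor remainder on both sides. *)
Lemma sqr_max0_taylor (t b : R) :
  0 <= Num.max (1 - b) 0 ^+ 2 - Num.max (1 - t) 0 ^+ 2 + 2 * Num.max (1 - t) 0 * (b - t)
    <= (b - t) ^+ 2.
Proof.
rewrite /Order.max; case: ltP => hb; case: ltP => ht.
- by rewrite expr0n /= mulr0 mul0r subrr addr0 lexx sqr_ge0.
- have -> : 0 ^+ 2 - (1 - t) ^+ 2 + 2 * (1 - t) * (b - t) = (1 - t) * ((1 - t) + 2 * (b - 1)).
    by ring.
  rewrite mulr_ge0//=; last by lra.
  have -> : (b - t) ^+ 2 = (1 - t) * (1 - t + 2 * (b - 1)) + (b - 1) ^+ 2 by ring.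
  by rewrite lerDl sqr_ge0.
- rewrite expr0n /= mulr0 mul0r subr0 addr0 sqr_ge0 /=.
  by rewrite -[leRHS]sqrrN opprB lerXn2r ?nnegrE//; lra.
- have -> : (1 - b) ^+ 2 - (1 - t) ^+ 2 + 2 * (1 - t) * (b - t) = (b - t) ^+ 2 by ring.
  by rewrite sqr_ge0 lexx.
Qed.

(** The Taylor bound at [x] is applied to [y] and to its mirror image; the first-order terms combine
    into a second difference of [sqdist], which is quadratic in [x - y]. *)
Lemma cutoff_sqr_second_diff x0 r M : 0 < r -> exists2 C : R, 0 <= C &
  forall x y, `|x0 - x| <= M -> `|x - y| <= 1 ->
  `|cutoff x0 r x ^+ 2 *+ 2 - cutoff x0 r y ^+ 2 - cutoff x0 r (x *+ 2 - y) ^+ 2| <=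
     C * `|x - y| ^+ 2.
Proof.
move=> r0; set N := n%:R : R; have N0 : 0 <= N by [].
(* [D] bounds the slope of the scaled squared distance between [x] and points within distance 1 of
   it. In the final constant, [2 * D ^+ 2] comes from the two Taylor remainders and [4 * N / r ^+ 2]
   from the first-order terms. *)
pose D := N * (2 * `|M| + 1) / r ^+ 2.
have r20 : 0 < r ^+ 2 by rewrite exprn_gt0.
have D0 : 0 <= D by rewrite divr_ge0 ?(ltW r20)// mulr_ge0// addr_ge0// mulr_ge0.
exists (4 * N / r ^+ 2 + 2 * D ^+ 2).
  by rewrite addr_ge0// ?mulr_ge0 ?sqr_ge0// ?invr_ge0 ltW.
move=> x y xM xy1; set z := x *+ 2 - y.
have xz : x - z = - (x - y) by apply/rowP => i; rewrite /z mulr2n !mxE; ring.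
pose t w := sqdist w x0 / r ^+ 2.
have tD w : `|x - w| = `|x - y| -> `|t w - t x| <= D * `|x - y|.
  move=> xw; rewrite /t -mulrBl normrM [`|_^-1|]ger0_norm ?invr_ge0 ?sqr_ge0//.
  rewrite /D mulrAC ler_pM2r ?invr_gt0//; apply: le_trans (sqdist_diff x0 w x) _.
  rewrite distrC xw -mulrA ler_wpM2l// mulrC ler_wpM2r//.
  have -> : x0 - w = (x0 - x) + (x - w) by rewrite addrA subrK.
  have := ler_normD (x0 - x) (x - w); rewrite xw; have := ler_norm M; lra.
have ty := tD y erefl.
have tz := tD z; rewrite xz normrN in tz; move/(_ erefl) in tz.
have t2 : `|t y + t z - 2 * t x| <= 2 * N / r ^+ 2 * `|x - y| ^+ 2.
  rewrite /t -mulrDl mulrA -mulrBl normrM [`|_^-1|]ger0_norm ?invr_ge0 ?sqr_ge0//.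
  by rewrite [leRHS]mulrAC ler_pM2r ?invr_gt0// sqdist_second_diff.
have := sqr_max0_taylor (t x) (t y); have := sqr_max0_taylor (t x) (t z).
rewrite -/(cutoff x0 r x) -/(cutoff x0 r y) -/(cutoff x0 r z).
have sq w : `|t w - t x| <= D * `|x - y| -> (t w - t x) ^+ 2 <= D ^+ 2 * `|x - y| ^+ 2.
  by move=> H; rewrite -[leLHS]real_normK ?num_real// -exprMn lerXn2r ?nnegrE// mulr_ge0.
have := sq _ ty; have := sq _ tz.
move: (cutoff_ge0 x0 r x) (cutoff_le1 x0 r x) t2.
set c := cutoff x0 r x; set T2 := 2 * N / r ^+ 2 * `|x - y| ^+ 2 => c0 c1 t2 H1 H2 H3 H4.
have ct : `|2 * c * (t y + t z - 2 * t x)| <= 2 * T2.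
  rewrite -mulrA normrM ger0_norm// ler_pM2l// normrM ger0_norm//.
  by rewrite -[leRHS]mul1r ler_pM.
have -> : (4 * N / r ^+ 2 + 2 * D ^+ 2) * `|x - y| ^+ 2 =
  2 * T2 + D ^+ 2 * `|x - y| ^+ 2 + D ^+ 2 * `|x - y| ^+ 2 by rewrite /T2; ring.
move: ct; rewrite !ler_norml mulr2n.
case/andP: H3 => H3 H3'; case/andP: H4 => H4 H4'; move/andP => [ct ct'].
rewrite -/c; apply/andP; split; lra.
Qed.

Lemma lipschitz_continuous_rV (f : 'rV[R]_n -> R) (L : R) : 0 <= L ->
  (forall x y, `|f x - f y| <= L * `|x - y|) -> continuous f.
Proof.
move=> L0 fL x; apply/(@cvgrPdist_lt _ _ _ _ (nbhs_filter x)) => e e0.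
have L1 : 0 < L + 1 by lra.
apply/nbhs_ballP; exists (e / (L + 1)); first by rewrite /= divr_gt0.
move=> y; rewrite -ball_normE /= => xy.
apply: (le_lt_trans (fL x y)).
apply: (@le_lt_trans _ _ ((L + 1) * `|x - y|)); first by rewrite ler_wpM2r// lerDl.
by rewrite mulrC -ltr_pdivlMr.
Qed.

Lemma continuous_cutoff x0 r : (0 < n)%N -> 0 < r -> continuous (cutoff x0 r).
Proof.
move=> n0 r0; apply: (@lipschitz_continuous_rV _ (3 * n%:R / r)).
  by rewrite divr_ge0// ?ltW// mulr_ge0.
by move=> x y; rewrite mulrAC -mulrA; exact: cutoff_lip.
Qed.

End cutoff.

(** * Integrals of the weighted and of the truncated kernel *)

Section kernel_bounds.
Context (R : realType) (n : nat) (s : R).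
Hypotheses (n2 : (2 <= n)%N) (s0 : 0 < s) (s1 : s < 1).

Local Notation leb := (lebesgue_rV R n).

(** The truncation is a 0-1 factor of the integrand, so that truncated integrals run over the whole
    space. *)
Definition trunc_kern (e : R) (h : 'rV[R]_n) : R := (e < enorm h)%R%:R * kern s h.

Lemma trunc_kern_ge0 e h : 0 <= trunc_kern e h.
Proof. by rewrite mulr_ge0 ?kern_ge0. Qed.

Lemma trunc_kernN e h : trunc_kern e (- h) = trunc_kern e h.
Proof. by rewrite /trunc_kern enormN kernN. Qed.

Lemma trunc_kern_le e h : trunc_kern e h <= kern s h.
Proof. by rewrite /trunc_kern; case: (_ < _); rewrite ?mul1r ?mul0r ?kern_ge0. Qed.

Lemma measurable_trunc_kern e : measurable_fun setT (trunc_kern e).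
Proof.
apply: measurable_funM; last exact: measurable_kern.
rewrite (_ : (fun _ => _) = \1_[set h : 'rV[R]_n | e < enorm h]).
  apply: measurable_indic; rewrite -[X in measurable X]setTI.
  rewrite (_ : [set h | _] = @enorm R n @^-1` `]e, +oo[); first exact: measurable_enorm.
  by apply/seteqP; split => h /=; rewrite in_itv /= andbT.
apply/funext => h; rewrite indicE; congr ((nat_of_bool _)%:R).
by apply/idP/idP; rewrite inE.
Qed.

(** One weight for two uses: at scale [r] it controls the squared increments of the cutoff, at scale
    1 the second differences of its square. *)
Definition sqmin (r : R) (h : 'rV[R]_n) : R := Num.min (`|h| ^+ 2 / r ^+ 2) 1.

Lemma sqmin_ge0 r h : 0 <= sqmin r h.
Proof. by rewrite le_min ler01 andbT divr_ge0 ?sqr_ge0. Qed.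

Lemma sqminN r h : sqmin r (- h) = sqmin r h.
Proof. by rewrite /sqmin normrN. Qed.

Lemma measurable_sqmin r : measurable_fun setT (sqmin r).
Proof.
apply: measurable_minr => //; apply: measurable_funM => //; apply: measurable_funX.
by apply: continuous_measurable_rV; exact: norm_continuous.
Qed.

(** Split at distance [r]. Inside, the weight lowers the exponent to n + 2 s - 2, below n since s <
    1; outside, n + 2 s exceeds n since s > 0. Both parts scale like r^(-2 s). *)
Lemma integral_sqmin_kern : exists2 C : R, 0 <= C & forall (x : 'rV[R]_n) r, 0 < r ->
  (\int[leb]_y (sqmin r (x - y) * kern s (x - y))%:E <= (C * r `^ (- (2 * s)))%:E)%E.
Proof.
have n2' : 2 <= n%:R :> R by rewrite ler_nat.
have a0 : 0 <= n%:R + 2 * s - 2 by rewrite subr_ge0 (le_trans n2')// lerDl mulr_ge0// ltW.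
have an : n%:R + 2 * s - 2 < n%:R by rewrite -addrA gtrDl subr_lt0 gtr_pMr.
have bn : n%:R < n%:R + 2 * s by rewrite ltrDl mulr_gt0.
have [C1 C10 HC1] := integral_cube_powR a0 an.
have [C2 C20 HC2] := integral_cubeC_powR bn.
exists (C1 + C2); first exact: addr_ge0.
move=> x r r0.
pose g1 y := \1_(cube x r) y * `|x - y| `^ (- (n%:R + 2 * s - 2)).
pose g2 y := \1_(~` cube x r) y * `|x - y| `^ (- (n%:R + 2 * s)).
have mg1 : measurable_fun setT g1.
  apply: measurable_funM; first by apply: measurable_indic; apply: measurable_cube; exact: ltW.
  by apply: (measurableT_comp (measurable_powR _)); exact: measurable_norm_sub.
have mg2 : measurable_fun setT g2.
  apply: measurable_funM.
    by apply: measurable_indic; apply: measurableC; apply: measurable_cube; exact: ltW.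
  by apply: (measurableT_comp (measurable_powR _)); exact: measurable_norm_sub.
have g10 y : 0 <= g1 y by rewrite mulr_ge0 ?powR_ge0.
have g20 y : 0 <= g2 y by rewrite mulr_ge0 ?powR_ge0.
apply: (@le_trans _ _ (\int[leb]_y (((r ^+ 2)^-1)%:E * (g1 y)%:E + (g2 y)%:E))%E).
  apply: ge0_le_integral => //.
  - by move=> y _; rewrite lee_fin mulr_ge0 ?sqmin_ge0 ?kern_ge0.
  - apply/measurable_EFinP; apply: measurable_funM.
      by apply: (measurableT_comp (measurable_sqmin _)); exact: measurable_refl_rV.
    by apply: (measurableT_comp (measurable_kern _)); exact: measurable_refl_rV.
  - apply: emeasurable_funD; last exact/measurable_EFinP.
    by apply/measurable_EFinP; apply: measurable_funM.
  - move=> y _; rewrite -EFinM -EFinD lee_fin /g1 /g2 !indicE.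
    set h := x - y.
    have [yr|yr] := boolP (y \in cube x r).
      rewrite (_ : y \in ~` _ = false) ?mul0r ?addr0 ?mul1r; last first.
        by apply/negbTE; rewrite in_setC yr.
      have [h0|h0] := eqVneq h 0.
        by rewrite h0 /sqmin normr0 expr0n /= mul0r min_l ?mul0r ?mulr_ge0// ?invr_ge0 ?powR_ge0 ?sqr_ge0.
      have nh : 0 < `|h| by rewrite normr_gt0.
      rewrite opprB powRD; last by apply/implyP => _; rewrite gt_eqF.
      rewrite powR_mulrn// mulrA [_^-1 * _]mulrC ler_pM ?sqmin_ge0 ?kern_ge0//.
        by rewrite /sqmin ge_min lexx.
      exact: kern_le.
    rewrite (_ : y \in ~` _ = true) ?mul0r ?mulr0 ?add0r ?mul1r; last by rewrite in_setC yr.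
    rewrite -[leRHS]mul1r ler_pM ?sqmin_ge0 ?kern_ge0 ?kern_le//.
    by rewrite /sqmin ge_min lexx orbT.
rewrite ge0_integralD//; last 4 first.
- by move=> y _; rewrite -EFinM lee_fin mulr_ge0 ?invr_ge0 ?sqr_ge0.
- by apply/measurable_EFinP; apply: measurable_funM.
- by move=> y _; rewrite lee_fin.
- exact/measurable_EFinP.
rewrite ge0_integralZl//; last 3 first.
- exact/measurable_EFinP.
- by move=> y _; rewrite lee_fin.
- by rewrite lee_fin invr_ge0 sqr_ge0.
rewrite mulrDl EFinD; apply: leeD; last first.
  by have := HC2 x r r0; rewrite (_ : n%:R - (n%:R + 2 * s) = - (2 * s)); last by ring.
apply: (@le_trans _ _ (((r ^+ 2)^-1)%:E * (C1 * r `^ (n%:R - (n%:R + 2 * s - 2)))%:E)%E).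
  by apply: lee_wpmul2l; [rewrite lee_fin invr_ge0 sqr_ge0|exact: HC1].
rewrite -EFinM lee_fin (_ : n%:R - (n%:R + 2 * s - 2) = 2 - 2 * s); last by ring.
rewrite powRD; last by apply/implyP => _; rewrite gt_eqF.
rewrite powR_mulrn ?(ltW r0)//; rewrite le_eqVlt; apply/orP; left; apply/eqP.
by field; rewrite gt_eqF.
Qed.

(** In the unit cube the truncation bounds the kernel by a constant; outside, the kernel decays
    integrably. Uniformity in [x] serves the Fubini criterion. *)
Lemma integral_trunc_kern (e : R) : 0 < e -> exists2 C : R, 0 <= C & forall x : 'rV[R]_n,
  (\int[leb]_y (trunc_kern e (x - y))%:E <= C%:E)%E.
Proof.
move=> e0.
have bn : n%:R < n%:R + 2 * s by rewrite ltrDl mulr_gt0.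
have ns : 0 <= n%:R + 2 * s by rewrite (le_trans _ (ltW bn)).
have [C2 C20 HC2] := integral_cubeC_powR bn.
pose k := e `^ (- (n%:R + 2 * s)).
exists (k * (2 * 1) ^+ n + C2 * 1 `^ (n%:R - (n%:R + 2 * s))).
  by rewrite addr_ge0 ?mulr_ge0 ?powR_ge0.
move=> x.
pose g2 y := \1_(~` cube x 1) y * `|x - y| `^ (- (n%:R + 2 * s)).
have mg1 : measurable_fun setT (\1_(cube x 1) : 'rV[R]_n -> R).
  by apply: measurable_indic; apply: measurable_cube.
have mg2 : measurable_fun setT g2.
  apply: measurable_funM.
    by apply: measurable_indic; apply: measurableC; apply: measurable_cube.
  by apply: (measurableT_comp (measurable_powR _)); exact: measurable_norm_sub.
have g20 y : 0 <= g2 y by rewrite mulr_ge0 ?powR_ge0.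
apply: (@le_trans _ _ (\int[leb]_y (k%:E * (\1_(cube x 1) y)%:E + (g2 y)%:E))%E).
  apply: ge0_le_integral => //.
  - by move=> y _; rewrite lee_fin trunc_kern_ge0.
  - apply/measurable_EFinP.
    by apply: (measurableT_comp (measurable_trunc_kern _)); exact: measurable_refl_rV.
  - apply: emeasurable_funD; last exact/measurable_EFinP.
    by apply/measurable_EFinP; apply: measurable_funM.
  - move=> y _; rewrite -EFinM -EFinD lee_fin /g2 !indicE.
    have [yr|yr] := boolP (y \in cube x 1).
      rewrite (_ : y \in ~` _ = false) ?mul0r ?addr0 ?mulr1; last first.
        by apply/negbTE; rewrite in_setC yr.
      rewrite /trunc_kern; case: ltP => eh; last by rewrite mul0r powR_ge0.
      by rewrite mul1r ler_powRN// ltW.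
    rewrite (_ : y \in ~` _ = true) ?mul0r ?mulr0 ?add0r ?mul1r; last by rewrite in_setC yr.
    by rewrite (le_trans (trunc_kern_le _ _))// kern_le.
rewrite ge0_integralD//; last 4 first.
- by move=> y _; rewrite -EFinM lee_fin mulr_ge0 ?powR_ge0.
- by apply/measurable_EFinP; apply: measurable_funM.
- by move=> y _; rewrite lee_fin.
- exact/measurable_EFinP.
rewrite ge0_integralZl//; last 2 first.
- exact/measurable_EFinP.
- by rewrite lee_fin powR_ge0.
rewrite integral_indic//; last exact: measurable_cube.
rewrite setIT [X in (_ * X)%E]lebesgue_cube// EFinD EFinM leeD2l//.
exact: HC2.
Qed.

End kernel_bounds.

(** * The fractional Laplacian of a test function *)

Section reflection.
Context (R : realType) (n : nat).

Local Notation leb := (lebesgue_rV R n).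

Lemma integral_refl_rV (c : 'rV[R]_n) (f : 'rV[R]_n -> \bar R) :
  leb.-integrable setT f -> leb.-integrable setT (f \o (fun y => c - y)) /\
  (\int[leb]_y f (c - y)%R = \int[leb]_y f y)%E.
Proof.
move=> intf.
have mf : measurable_fun setT f := measurable_int _ intf.
have mc := @measurable_refl_rV R n c.
have invE (g : 'rV[R]_n -> \bar R) :
    (\int[pushforward leb (fun y : 'rV[R]_n => c - y)%R]_y g y = \int[leb]_y g y)%E.
  by apply: eq_measure_integral => // A mA _; exact: lebesgue_refl.
have intfc : leb.-integrable setT (f \o (fun y => c - y)).
  apply/integrableP; split; first exact: (measurableT_comp mf mc).
  have mabs : measurable_fun setT (abse \o f) by apply: measurableT_comp.
  have := @ge0_integral_pushforward _ _ _ _ _ _ mc leb setT (abse \o f) measurableT mabs.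
  rewrite preimage_setT /= => <-; last by move=> y _; exact: abse_ge0.
  by rewrite invE; have /integrableP[] := intf.
split => //; rewrite -[RHS]invE (integral_pushforward mc) ?preimage_setT//.
Qed.

End reflection.

Section trunc_quotient.
Context (R : realType) (n : nat) (s : R) (psi : 'rV[R]_n -> R).

Local Notation leb := (lebesgue_rV R n).

Lemma frac_lap_truncE (x : 'rV[R]_n) e : frac_lap_trunc s psi x e =
  Rintegral leb setT (fun y => (psi x - psi y) * trunc_kern s e (x - y)).
Proof.
rewrite /frac_lap_trunc Rintegral_mkcond; apply: eq_Rintegral => y _.
rewrite patchE /trunc_kern /frac_lap_quotient kernE.
case: ifPn; first by rewrite inE /= => ->; rewrite mul1r.
by move=> /negP H; case: ltP => h; [exfalso; apply: H; rewrite inE|rewrite mul0r mulr0].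
Qed.

Lemma measurable_trunc_kern_sub (x : 'rV[R]_n) e :
  measurable_fun setT (fun y : 'rV[R]_n => trunc_kern s e (x - y)).
Proof.
by apply: (measurableT_comp (measurable_trunc_kern _ _)); exact: measurable_refl_rV.
Qed.

Lemma integrable_trunc_kern (x : 'rV[R]_n) e : 0 < s -> 0 < e ->
  leb.-integrable setT (fun y => (trunc_kern s e (x - y))%:E).
Proof.
move=> s0 e0; have [Ce Ce0 HCe] := @integral_trunc_kern R n s s0 e e0.
apply/integrableP; split.
  by apply/measurable_EFinP; exact: measurable_trunc_kern_sub.
under eq_integral do rewrite gee0_abs ?lee_fin ?trunc_kern_ge0//.
by rewrite (le_lt_trans (HCe _))// ltry.
Qed.

Lemma integrable_trunc_quotient (x : 'rV[R]_n) e : 0 < s -> 0 < e ->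
  measurable_fun setT psi -> (forall y, 0 <= psi y <= 1) ->
  leb.-integrable setT (fun y => ((psi x - psi y) * trunc_kern s e (x - y))%:E).
Proof.
move=> s0 e0 mpsi psi01; have iK := integrable_trunc_kern x s0 e0.
apply: (le_integrable _ _ _ iK) => //.
  apply/measurable_EFinP; apply: measurable_funM; first exact: measurable_funB.
  exact: measurable_trunc_kern_sub.
move=> y _; rewrite /= lee_fin normrM ler_piMl//.
have := (psi01 x, psi01 y); case=> /andP[? ?] /andP[? ?].
by rewrite ler_norml; lra.
Qed.

End trunc_quotient.

Section frac_lap_test.
Context (R : realType) (n : nat) (s : R).
Hypotheses (n2 : (2 <= n)%N) (s0 : 0 < s) (s1 : s < 1).

Local Notation leb := (lebesgue_rV R n).

Variables (psi : 'rV[R]_n -> R) (x : 'rV[R]_n) (C CJ : R).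
Hypothesis mpsi : measurable_fun setT psi.
Hypothesis psi01 : forall y, 0 <= psi y <= 1.
Hypothesis C0 : 0 <= C.
Hypothesis psi2 : forall y,
  `|psi x *+ 2 - psi y - psi (x *+ 2 - y)| <= C * sqmin 1 (x - y).
Hypothesis CJP : (\int[leb]_y (sqmin 1 (x - y) * kern s (x - y))%:E <= CJ%:E)%E.

Let Q e (y : 'rV[R]_n) := (psi x - psi y) * trunc_kern s e (x - y).
(** [S] is the mean of [psi x - psi y] and of its value at the reflected point, hence of second
    order near [x]; [C * J] will be the common integrable majorant. *)
Let S (y : 'rV[R]_n) := (psi x *+ 2 - psi y - psi (x *+ 2 - y)) / 2.
Let J (y : 'rV[R]_n) := sqmin 1 (x - y) * kern s (x - y).

Let mtk e := @measurable_trunc_kern_sub R n s x e.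

Let mS : measurable_fun setT S.
Proof.
apply: measurable_funM => //; apply: measurable_funB.
  by apply: measurable_funB.
by apply: (measurableT_comp mpsi); exact: measurable_refl_rV.
Qed.

Let mJ : measurable_fun setT J.
Proof.
apply: measurable_funM.
  by apply: (measurableT_comp (@measurable_sqmin R n 1)); exact: measurable_refl_rV.
by apply: (measurableT_comp (measurable_kern _)); exact: measurable_refl_rV.
Qed.

Let J0 y : 0 <= J y.
Proof. by rewrite mulr_ge0 ?sqmin_ge0 ?kern_ge0. Qed.

Let intCJ : leb.-integrable setT (fun y => (C * J y)%:E).
Proof.
apply: (@eq_integrable _ _ _ _ _ measurableT (fun y => C%:E * (J y)%:E)%E) => //.
apply: integrableZl => //; apply/integrableP; split; first exact/measurable_EFinP.
under eq_integral do rewrite gee0_abs ?lee_fin//.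
by rewrite (le_lt_trans CJP)// ltry.
Qed.

Let intCJ_le : (\int[leb]_y (C * J y)%:E <= (C * CJ)%:E)%E.
Proof.
under eq_integral do rewrite EFinM.
rewrite ge0_integralZl//.
- by rewrite EFinM; apply: lee_wpmul2l; rewrite ?lee_fin.
- exact/measurable_EFinP.
- by move=> y _; rewrite lee_fin.
Qed.

(** Any [k] up to the kernel is allowed, so the truncated integrands and their limit are dominated
    alike. *)
Let S_le (k : R) y : 0 <= k -> k <= kern s (x - y) -> `|S y * k| <= C * J y.
Proof.
move=> k0 kk; rewrite normrM (ger0_norm k0) /J mulrA ler_pM//.
rewrite /S normrM [`|2^-1|]ger0_norm// ler_pdivrMr//.
by rewrite (le_trans (psi2 y))// ler_peMr ?mulr_ge0 ?sqmin_ge0//; lra.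
Qed.

Let intS e : leb.-integrable setT (fun y => (S y * trunc_kern s e (x - y))%:E).
Proof.
apply: (le_integrable _ _ _ intCJ) => //.
  by apply/measurable_EFinP; exact: measurable_funM.
move=> y _; rewrite /= lee_fin [leRHS]ger0_norm ?(mulr_ge0 C0 (J0 y))//.
by apply: S_le; [exact: trunc_kern_ge0|exact: trunc_kern_le].
Qed.

Let intQ e : 0 < e -> leb.-integrable setT (fun y => (Q e y)%:E).
Proof. by move=> e0; exact: integrable_trunc_quotient. Qed.

(* Averaging over the reflection y |-> 2 x - y cancels the first-order term of
   psi x - psi y, which makes the truncated integrals uniformly bounded. *)
Let trunc_symE e : 0 < e ->
  frac_lap_trunc s psi x e = fine (\int[leb]_y (S y * trunc_kern s e (x - y))%:E)%E.
Proof.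
move=> e0; rewrite frac_lap_truncE /Rintegral; congr fine.
have iQ := intQ e0.
have [iQ' QE] := integral_refl_rV (x *+ 2) iQ.
have -> : (fun y => (S y * trunc_kern s e (x - y))%:E) =
    (fun y => (2^-1)%:E * ((Q e y)%:E + (Q e (x *+ 2 - y))%:E))%E.
  apply/funext => y; rewrite -EFinD -EFinM; congr EFin.
  rewrite /Q (_ : x - (x *+ 2 - y) = - (x - y)); last first.
    by apply/rowP => i; rewrite mulr2n !mxE; ring.
  by rewrite trunc_kernN /S mulr2n; field.
have iD := integrableD measurableT iQ iQ'.
rewrite (integralZl measurableT iD) (integralD measurableT iQ iQ') [X in (_ + X)%E]QE.
have : (\int[leb]_y (Q e y)%:E)%E \is a fin_num by exact: (integrable_fin_num measurableT iQ).
by move/fineK => <-; rewrite -EFinD -EFinM; congr EFin; field.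
Qed.

Lemma frac_lap_trunc_bound e : 0 < e -> `|frac_lap_trunc s psi x e| <= C * CJ.
Proof.
move=> e0; rewrite trunc_symE//.
have fS : (\int[leb]_y (S y * trunc_kern s e (x - y))%:E)%E \is a fin_num.
  exact: (integrable_fin_num measurableT (intS e)).
rewrite -lee_fin.
have -> : (`|fine (\int[leb]_y (S y * trunc_kern s e (x - y))%:E)%E|)%:E =
    `|\int[leb]_y (S y * trunc_kern s e (x - y))%:E|%E by rewrite -{2}(fineK fS).
apply: le_trans intCJ_le; apply: (le_trans (le_abse_integral _ measurableT (measurable_int _ (intS e)))).
apply: ge0_le_integral => //.
- by apply: measurableT_comp; [exact: abse_measurable|exact: measurable_int (intS e)].
- exact: measurable_int intCJ.
- move=> y _; rewrite /= lee_fin.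
  by apply: S_le; [exact: trunc_kern_ge0|exact: trunc_kern_le].
Qed.

Let trunc_kern_cvg (u : R^nat) h : (forall k, 0 < u k) -> u @ \oo --> 0 ->
  trunc_kern s (u k) h @[k --> \oo] --> kern s (h : 'rV[R]_n).
Proof.
move=> u0 ucvg; have [->|h0] := eqVneq h 0.
  (* At the origin the kernel and its truncations are all zero; elsewhere the truncation is
     eventually inactive. *)
  have k0 : kern s (0 : 'rV[R]_n) = 0.
    rewrite /kern enorm0 powR0// oppr_eq0 gt_eqF// ltr_wpDl// mulr_gt0//.
  rewrite k0; apply: cvg_near_cst; apply: nearW => k.
  by rewrite /trunc_kern k0 mulr0.
apply: cvg_near_cst.
have H := cvgr_lt 0 ucvg (enorm h) (enorm_gt0 h0).
near=> k; suff uk : u k < enorm h by rewrite /trunc_kern uk mul1r.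
by near: k; exact: H.
Unshelve. all: end_near. Qed.

Let trunc_cvg : frac_lap_trunc s psi x e @[e --> 0^'+] -->
  fine (\int[leb]_y (S y * kern s (x - y))%:E)%E.
Proof.
have intSk : leb.-integrable setT (fun y => (S y * kern s (x - y))%:E).
  apply: (le_integrable _ _ _ intCJ) => //.
    apply/measurable_EFinP; apply: measurable_funM => //.
    by apply: (measurableT_comp (measurable_kern _)); exact: measurable_refl_rV.
  move=> y _; rewrite /= lee_fin [leRHS]ger0_norm ?(mulr_ge0 C0 (J0 y))//.
  by apply: S_le; rewrite ?kern_ge0.
(* Dominated convergence is about sequences, hence the sequential form of the right-hand limit. *)
apply/cvg_at_rightP => u [u0 ucvg].
under eq_fun do rewrite trunc_symE//.
apply: fine_cvg; rewrite fineK; last exact: (integrable_fin_num measurableT intSk).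
apply: (@dominated_cvg _ _ _ _ _ measurableT _ _ (fun y => (C * J y)%:E)) => //.
- by move=> k; exact: measurable_int (intS _).
- move=> y _; apply: cvg_EFin; first exact: nearW.
  by apply: cvgM; [exact: cvg_cst|exact: trunc_kern_cvg].
- move=> k y _; rewrite /= lee_fin.
  by apply: S_le; [exact: trunc_kern_ge0|exact: trunc_kern_le].
Qed.

Lemma frac_lap_exists_test : frac_lap_exists s psi x.
Proof.
split; last by apply/cvg_ex; eexists; exact: trunc_cvg.
move=> e e0.
have mD : measurable [set y : 'rV[R]_n | e < enorm (x - y)].
  rewrite -[X in measurable X]setTI.
  rewrite (_ : [set y | _] = (@enorm R n \o (fun y => x - y)) @^-1` `]e, +oo[).
    by apply: measurableT_comp => //; [exact: measurable_enorm|exact: measurable_refl_rV].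
  by apply/seteqP; split => h /=; rewrite in_itv /= andbT.
apply/(integrable_mkcond _ mD).
apply: (eq_integrable _ _ _ _ (intQ e0)) => // y _.
rewrite patchE /Q /trunc_kern /= /frac_lap_quotient kernE.
case: ifPn; first by rewrite inE /= => ->; rewrite mul1r.
by move=> /negP H; case: ltP => h; [exfalso; apply: H; rewrite inE|rewrite mul0r mulr0].
Qed.

Lemma frac_lap_trunc_cvg :
  frac_lap_trunc s psi x e @[e --> 0^'+] --> frac_lap s psi x.
Proof. by have -> : frac_lap s psi x = _ := cvg_lim (@Rhausdorff R) trunc_cvg. Qed.

Lemma frac_lap_bound : `|frac_lap s psi x| <= C * CJ.
Proof.
have H : `|frac_lap_trunc s psi x e| @[e --> 0^'+] --> `|frac_lap s psi x|.
  by apply: cvg_norm; exact: frac_lap_trunc_cvg.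
rewrite -(cvg_lim (@Rhausdorff R) H); apply: limr_le; first by apply/cvg_ex; eexists; exact: H.
by near=> e; apply: frac_lap_trunc_bound; near: e; exact: nbhs_right_gt.
Unshelve. all: end_near. Qed.

End frac_lap_test.

(** * The energy inequality *)

Lemma lee_double (R : realType) (a b : \bar R) : a \is a fin_num -> b \is a fin_num ->
  (a + a <= b + b -> a <= b)%E.
Proof. by move=> /fineK <- /fineK <-; rewrite -!EFinD !lee_fin => h; lra. Qed.

Section energy.
Context (R : realType) (n : nat) (s : R).

Local Notation rV := 'rV[R]_n.
Local Notation leb := (lebesgue_rV R n).

Lemma measurable_kern_sub : measurable_fun setT (fun z : rV * rV => kern s (z.1 - z.2)).
Proof. by apply: (measurableT_comp (measurable_kern _)); exact: measurable_sub_rV. Qed.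

Lemma measurable_fst_comp (f : rV -> R) :
  measurable_fun setT f -> measurable_fun setT (fun z : rV * rV => f z.1).
Proof. by move=> mf; apply: (measurableT_comp mf); exact: measurable_fst. Qed.

Lemma measurable_snd_comp (f : rV -> R) :
  measurable_fun setT f -> measurable_fun setT (fun z : rV * rV => f z.2).
Proof. by move=> mf; apply: (measurableT_comp mf); exact: measurable_snd. Qed.

Variable u : rV -> R.
Hypothesis um : measurable_fun setT u.

Let E2 (z : rV * rV) : R := `|u z.1 - u z.2| ^+ 2 * kern s (z.1 - z.2).

Let mE2 : measurable_fun setT E2.
Proof.
apply: measurable_funM; last exact: measurable_kern_sub.
apply: measurable_funX; apply: measurableT_comp => //.
by apply: measurable_funB; [exact: measurable_fst_comp|exact: measurable_snd_comp].
Qed.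

Let E20 z : 0 <= E2 z.
Proof. by rewrite mulr_ge0 ?kern_ge0 ?exprn_ge0. Qed.

Let Ds2E x : Ds2 s u x = (\int[leb]_y (E2 (x, y))%:E)%E.
Proof. by apply: eq_integral => y _; rewrite kernE. Qed.

Lemma Ds2_ge0 x : (0 <= Ds2 s u x)%E.
Proof. by rewrite Ds2E; apply: integral_ge0 => y _; rewrite lee_fin. Qed.

Lemma measurable_Ds2 : measurable_fun setT (Ds2 s u).
Proof.
rewrite (_ : Ds2 s u = fubini_F leb (fun z => (E2 z)%:E)); last first.
  by apply/funext => x; rewrite Ds2E.
apply: measurable_fun_fubini_tonelli_F; last by move=> z; rewrite lee_fin.
exact/measurable_EFinP.
Qed.

Variables (phi : rV -> R) (m : rV -> R) (B : set rV) (e c : R).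
Hypotheses (s0 : 0 < s) (e0 : 0 < e) (c0 : 0 < c).
Hypothesis iu : leb.-integrable setT (EFin \o u).
Hypothesis mphi : measurable_fun setT phi.
Hypothesis phi01 : forall x, 0 <= phi x <= 1.
Hypothesis mm : measurable_fun setT m.
Hypothesis m0 : forall h, 0 <= m h.
Hypothesis mN : forall h, m (- h) = m h.
Hypothesis mB : measurable B.
(** Swapping the two points exchanges the indicators, which is why [H2] below carries only one of
    them. *)
Hypothesis phiB : forall x y, (phi x - phi y) ^+ 2 <= m (x - y) * (\1_B x + \1_B y).

Let psi x := phi x ^+ 2.

Let mpsi : measurable_fun setT psi.
Proof. exact: measurable_funX. Qed.

Let psi01 x : 0 <= psi x <= 1.
Proof. by have /andP[p0 p1] := phi01 x; rewrite exprn_ge0//= exprn_ile1. Qed.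

Let F (z : rV * rV) : R := u z.1 * ((psi z.1 - psi z.2) * trunc_kern s e (z.1 - z.2)).

Let mF : measurable_fun setT F.
Proof.
apply: measurable_funM; first exact: measurable_fst_comp.
apply: measurable_funM.
  by apply: measurable_funB; [exact: measurable_fst_comp|exact: measurable_snd_comp].
by apply: (measurableT_comp (measurable_trunc_kern _ _)); exact: measurable_sub_rV.
Qed.

(** For [e > 0] the inner integral is at most a constant times |u x|, and [u] is integrable. *)
Let iF : (leb \x leb)%E.-integrable setT (EFin \o F).
Proof.
have [Ce Ce0 HCe] := @integral_trunc_kern R n s s0 e e0.
apply/integrable12ltyP; first exact/measurable_EFinP.
apply: (@le_lt_trans _ _ (\int[leb]_x (Ce%:E * `|(u x)%:E|))%E); last first.
  rewrite ge0_integralZl//; last by apply: measurableT_comp => //; exact/measurable_EFinP.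
  have /integrableP[_ iu'] := iu.
  by rewrite lte_mul_pinfty.
apply: ge0_le_integral => //.
- by move=> x _; exact: integral_ge0.
- apply: (measurable_fun_fubini_tonelli_F (m2 := leb) (fun z => `|(F z)%:E|%E)) => //.
  by apply: measurableT_comp => //; exact/measurable_EFinP.
- apply: emeasurable_funM => //; apply: measurableT_comp => //; exact/measurable_EFinP.
- move=> x _.
  apply: (@le_trans _ _ (\int[leb]_y (`|(u x)|%:E * (trunc_kern s e (x - y))%:E))%E).
    apply: ge0_le_integral => //.
    + have mFx : measurable_fun setT (fun y => (F (x, y))%:E).
        by apply/measurable_EFinP; exact: (measurable_fun_pair2 _ mF).
      exact: (measurableT_comp (@abse_measurable R setT) mFx).
    + have mT : measurable_fun setT (fun y : rV => (trunc_kern s e (x - y))%:E).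
        by apply/measurable_EFinP; exact: measurable_trunc_kern_sub.
      by apply: emeasurable_funM.
    + move=> y _; rewrite /F /= lee_fin normrM ler_wpM2l// normrM.
      rewrite (ger0_norm (trunc_kern_ge0 _ _ _)) ler_piMl ?trunc_kern_ge0//.
      have := (psi01 x, psi01 y); case=> /andP[? ?] /andP[? ?].
      by rewrite ler_norml; lra.
  rewrite ge0_integralZl//.
  - by rewrite muleC; apply: lee_wpmul2r; [rewrite lee_fin|exact: HCe].
  - by apply/measurable_EFinP; exact: measurable_trunc_kern_sub.
  - by move=> y _; rewrite lee_fin trunc_kern_ge0.
Qed.

Let FE x : fubini_F leb (EFin \o F) x = (u x * frac_lap_trunc s psi x e)%:E.
Proof.
rewrite /fubini_F /F /=; under eq_integral do rewrite EFinM.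
have iQ := integrable_trunc_quotient x s0 e0 mpsi psi01.
rewrite integralZl// EFinM frac_lap_truncE; congr (_ * _)%E.
by rewrite /Rintegral fineK//; exact: integrable_fin_num.
Qed.

Lemma measurable_frac_lap_trunc :
  measurable_fun setT (fun x => (u x * frac_lap_trunc s psi x e)%:E).
Proof.
rewrite (_ : (fun _ => _) = fubini_F leb (EFin \o F)); last first.
  by apply/funext => x; rewrite FE.
exact: (measurable_fubini_F iF).
Qed.

(** [H1] integrates to the term to be absorbed, [H2] to the energy bound of the cutoff. [F] is
    compared with their sum only after both orders of the pair are added. *)
Let H1 (z : rV * rV) : R := c * (phi z.1 ^+ 2 * E2 z).
Let H2 (z : rV * rV) : R := (2 * c)^-1 * (\1_B z.1 * (m (z.1 - z.2) * kern s (z.1 - z.2))).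

Let H10 z : 0 <= H1 z.
Proof. by rewrite /H1 mulr_ge0 ?(ltW c0)// mulr_ge0// sqr_ge0. Qed.

Let H20 z : 0 <= H2 z.
Proof. by rewrite /H2 mulr_ge0 ?mulr_ge0 ?kern_ge0// invr_ge0 mulr_ge0// ltW. Qed.

Let mmk : measurable_fun setT (fun z : rV * rV => m (z.1 - z.2) * kern s (z.1 - z.2)).
Proof.
apply: measurable_funM; last exact: measurable_kern_sub.
by apply: (measurableT_comp mm); exact: measurable_sub_rV.
Qed.

Let mH1 : measurable_fun setT H1.
Proof.
apply: measurable_funM => //; apply: measurable_funM => //.
exact: (measurable_fst_comp mpsi).
Qed.

Let mH2 : measurable_fun setT H2.
Proof.
apply: measurable_funM => //; apply: measurable_funM => //.
by apply: measurable_fst_comp; exact: measurable_indic.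
Qed.

Let H (z : rV * rV) : \bar R := ((H1 z)%:E + (H2 z)%:E)%E.

Let mH : measurable_fun setT H.
Proof. by apply: emeasurable_funD; exact/measurable_EFinP. Qed.

Let H0 z : (0 <= H z)%E.
Proof. by rewrite adde_ge0 ?lee_fin. Qed.

Let intH : (\int[leb \x leb]_z H z = c%:E * \int[leb]_x ((phi x ^+ 2)%:E * Ds2 s u x)
  + (2 * c)^-1%:E * \int[leb]_x ((\1_B x)%:E * \int[leb]_y (m (x - y) * kern s (x - y))%:E))%E.
Proof.
rewrite ge0_integralD//; last 4 first.
- by move=> z _; rewrite lee_fin.
- exact/measurable_EFinP.
- by move=> z _; rewrite lee_fin.
- exact/measurable_EFinP.
congr (_ + _)%E.
  rewrite fubini_tonelli1//; last exact/measurable_EFinP.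
  rewrite -ge0_integralZl//; last 3 first.
  - apply: emeasurable_funM; [exact/measurable_EFinP|exact: measurable_Ds2].
  - by move=> x _; rewrite mule_ge0 ?Ds2_ge0// lee_fin sqr_ge0.
  - by rewrite lee_fin ltW.
  apply: eq_integral => x _; rewrite /fubini_F /H1 Ds2E.
  transitivity (\int[leb]_y ((c * phi x ^+ 2)%:E * (E2 (x, y))%:E))%E.
    by apply: eq_integral => y _; rewrite -EFinM mulrA.
  rewrite ge0_integralZl//; last 3 first.
  - apply/measurable_EFinP; exact: (measurable_fun_pair2 _ mE2).
  - by move=> y _; rewrite lee_fin.
  - by rewrite lee_fin mulr_ge0 ?sqr_ge0 ?(ltW c0).
  by rewrite EFinM muleA.
rewrite fubini_tonelli1//; last exact/measurable_EFinP.
have mI : measurable_fun setT (fun x : rV => \int[leb]_y (m (x - y) * kern s (x - y))%:E)%E.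
  apply: (measurable_fun_fubini_tonelli_F (m2 := leb)
    (fun z : rV * rV => (m (z.1 - z.2) * kern s (z.1 - z.2))%:E)).
    exact/measurable_EFinP.
  by move=> z; rewrite lee_fin mulr_ge0 ?kern_ge0.
rewrite -ge0_integralZl//; last 3 first.
- by apply: emeasurable_funM => //; apply/measurable_EFinP; exact: measurable_indic.
- move=> x _; rewrite mule_ge0 ?lee_fin//; apply: integral_ge0 => y _.
  by rewrite lee_fin mulr_ge0 ?kern_ge0.
- by rewrite lee_fin invr_ge0 mulr_ge0// ltW.
apply: eq_integral => x _; rewrite /fubini_F /H2.
transitivity (\int[leb]_y (((2 * c)^-1 * \1_B x)%:E * (m (x - y) * kern s (x - y))%:E))%E.
  by apply: eq_integral => y _; rewrite -EFinM mulrA.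
rewrite ge0_integralZl//; last 3 first.
- apply/measurable_EFinP; exact: (measurable_fun_pair2 _ mmk).
- by move=> y _; rewrite lee_fin mulr_ge0 ?kern_ge0.
- by rewrite lee_fin mulr_ge0 ?invr_ge0 ?mulr_ge0 ?(ltW c0).
by rewrite EFinM muleA.
Qed.

Let sw (z : rV * rV) : rV * rV := (z.2, z.1).

Let msw : measurable_fun setT sw.
Proof. exact: measurable_fun_pair. Qed.

Let FH_real x y : F (x, y) + F (y, x) <=
  (H1 (x, y) + H2 (x, y)) + (H1 (y, x) + H2 (y, x)).
Proof.
rewrite /F /H1 /H2 /E2 /=.
rewrite -(opprB x y) trunc_kernN kernN mN.
have /andP[p0 p1] := phi01 x; have /andP[q0 q1] := phi01 y.
have := phiB x y; have := m0 (x - y).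
have := trunc_kern_le s e (x - y); have := trunc_kern_ge0 s e (x - y).
rewrite [`|u y - _|]distrC -[`|_| ^+ 2]normrX (ger0_norm (sqr_ge0 _)) /psi.
set k := kern s _; set t := trunc_kern s e _; set M := m _.
set p := phi x; set q := phi y; set a := u x; set b := u y.
move: (\1_B x : R) (\1_B y : R) => i j t0 tk M0 Mij.
pose E := c * (p ^+ 2 + q ^+ 2) * (a - b) ^+ 2 + (2 * c)^-1 * (p - q) ^+ 2.
have E0 : 0 <= E.
  rewrite addr_ge0// mulr_ge0 ?sqr_ge0//; last by rewrite invr_ge0 mulr_ge0// ltW.
  by rewrite mulr_ge0 ?addr_ge0 ?sqr_ge0// ltW.
apply: (@le_trans _ _ (E * t)).
  have -> : a * ((p ^+ 2 - q ^+ 2) * t) + b * ((q ^+ 2 - p ^+ 2) * t) =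
    ((a - b) * (p - q) * (p + q)) * t by ring.
  (* AM-GM, as an explicit sum of squares *)
  rewrite ler_wpM2r// /E -subr_ge0.
  have -> : c * (p ^+ 2 + q ^+ 2) * (a - b) ^+ 2 + (2 * c)^-1 * (p - q) ^+ 2 -
     (a - b) * (p - q) * (p + q) =
    ((2 * c * p * (a - b) - (p - q)) ^+ 2 + (2 * c * q * (a - b) - (p - q)) ^+ 2) / (4 * c).
    by field; rewrite gt_eqF.
  by rewrite divr_ge0 ?addr_ge0 ?sqr_ge0// mulr_ge0// ltW.
(* Since [E] is nonnegative, the full kernel may replace the truncated one; from here on nothing
   depends on [e]. *)
apply: (@le_trans _ _ (E * k)); first by rewrite ler_wpM2l.
have -> : c * (p ^+ 2 * ((a - b) ^+ 2 * k)) + (2 * c)^-1 * (i * (M * k)) +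
  (c * (q ^+ 2 * ((a - b) ^+ 2 * k)) + (2 * c)^-1 * (j * (M * k))) =
  (c * (p ^+ 2 + q ^+ 2) * (a - b) ^+ 2 + (2 * c)^-1 * (M * (i + j))) * k by ring.
rewrite ler_wpM2r ?kern_ge0// /E lerD2l ler_wpM2l//.
by rewrite invr_ge0 mulr_ge0// ltW.
Qed.

Let FH z : ((F z)%:E + (F (sw z))%:E <= H z + H (sw z))%E.
Proof. by case: z => x y; exact: FH_real. Qed.

Lemma energy_le :
  (\int[leb]_x (u x * frac_lap_trunc s psi x e)%:E <=
   c%:E * \int[leb]_x ((phi x ^+ 2)%:E * Ds2 s u x) +
   (2 * c)^-1%:E * \int[leb]_x ((\1_B x)%:E * \int[leb]_y (m (x - y) * kern s (x - y))%:E))%E.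
Proof.
rewrite -intH.
rewrite (eq_integral (fubini_F leb (EFin \o F))); last by move=> x _; rewrite FE.
rewrite (integral12_prod_meas1 iF).
have mFs : measurable_fun setT (EFin \o F \o sw).
  by apply: measurableT_comp => //; exact/measurable_EFinP.
have iFs : (leb \x leb)%E.-integrable setT (EFin \o F \o sw).
  apply/integrable21ltyP => //.
  by have /integrable12ltyP := iF; apply; exact/measurable_EFinP.
(* Integrating the swapped function in the other order gives the same iterated integral. *)
have swF : (\int[leb \x leb]_z (EFin \o F \o sw) z = \int[leb \x leb]_z (EFin \o F) z)%E.
  transitivity (\int[leb]_x fubini_F leb (EFin \o F) x)%E.
    by rewrite -(integral21_prod_meas1 iFs); exact: eq_integral.
  exact: (integral12_prod_meas1 iF).
have mHs : measurable_fun setT (H \o sw) := measurableT_comp mH msw.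
have swH : (\int[leb \x leb]_z (H \o sw) z = \int[leb \x leb]_z H z)%E.
  transitivity (\int[leb]_x fubini_F leb H x)%E.
    rewrite (@fubini_tonelli2 _ _ _ _ R leb leb (H \o sw) mHs (fun z => H0 (sw z))).
    exact: eq_integral.
  by rewrite (@fubini_tonelli1 _ _ _ _ R leb leb H mH H0).
(* An infinite right-hand side leaves nothing to prove; otherwise [H] is integrable, integrals add
   up, and the symmetrized inequality can be halved. *)
have [Hoo|Hfin] := eqVneq (\int[leb \x leb]_z H z)%E +oo%E.
  by rewrite Hoo leey.
have iH : (leb \x leb)%E.-integrable setT H.
  apply/integrableP; split; first exact: mH.
  rewrite (eq_integral H); first by rewrite ltey.
  by move=> z _; rewrite gee0_abs.
have iHs : (leb \x leb)%E.-integrable setT (H \o sw).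
  apply/integrableP; split; first exact: mHs.
  rewrite (eq_integral (H \o sw)); first by rewrite swH ltey.
  by move=> z _; exact: (gee0_abs (H0 (sw z))).
have eF := etrans (integralD measurableT iF iFs) (congr1 (adde _) swF).
have eH := etrans (integralD measurableT iH iHs) (congr1 (adde _) swH).
have le2 := le_integral measurableT (integrableD measurableT iF iFs)
  (integrableD measurableT iH iHs) (fun z _ => FH z).
rewrite eF eH in le2.
have fF : (\int[leb \x leb]_z (EFin \o F) z)%E \is a fin_num := integrable_fin_num measurableT iF.
have fH : (\int[leb \x leb]_z H z)%E \is a fin_num := integrable_fin_num measurableT iH.
exact: (lee_double fF fH le2).
Qed.

End energy.

(** * The squared cutoff is an admissible test function *)

Section test_function.
Context (R : realType) (n : nat) (s : R).
Hypotheses (n2 : (2 <= n)%N) (s0 : 0 < s) (s1 : s < 1).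

Local Notation rV := 'rV[R]_n.
Local Notation leb := (lebesgue_rV R n).

Variables (x0 : rV) (r : R).
Hypothesis r0 : 0 < r.

Let phi := cutoff x0 r.
Let psi (x : rV) := cutoff x0 r x ^+ 2.

Let n0 : (0 < n)%N. Proof. exact: leq_trans n2. Qed.

Lemma measurable_cutoff : measurable_fun setT phi.
Proof. by apply: continuous_measurable_rV; exact: continuous_cutoff. Qed.

Lemma cutoff_sqr01 x : 0 <= psi x <= 1.
Proof. by rewrite exprn_ge0 ?cutoff_ge0//= exprn_ile1 ?cutoff_ge0 ?cutoff_le1. Qed.

Lemma continuous_cutoff_sqr : continuous psi.
Proof.
apply: (@lipschitz_continuous_rV _ _ _ (2 * (3 * n%:R / r))).
  by rewrite mulr_ge0// divr_ge0 ?(ltW r0)// mulr_ge0.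
move=> x y; rewrite /psi subr_sqr normrM.
have -> : 2 * (3 * n%:R / r) * `|x - y| = 3 * n%:R * (`|x - y| / r) * 2 by ring.
rewrite ler_pM//; first exact: cutoff_lip.
have := (cutoff_ge0 x0 r x, cutoff_le1 x0 r x, cutoff_ge0 x0 r y, cutoff_le1 x0 r y).
by case=> -[[? ?] ?] ?; rewrite ler_norml; lra.
Qed.

Lemma cutoff_sqr_second_diff_sqmin M : exists2 C : R, 0 <= C &
  forall x y, `|x0 - x| <= M ->
  `|psi x *+ 2 - psi y - psi (x *+ 2 - y)| <= C * sqmin 1 (x - y).
Proof.
have [C C0 HC] := cutoff_sqr_second_diff x0 M r0.
(* The 2 covers points at distance more than 1: [psi] takes values between 0 and 1, so its second
   differences are at most 2. *)
exists (C + 2); first exact: addr_ge0.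
move=> x y xM; rewrite /sqmin expr1n divr1; case: (leP (`|x - y|) 1) => xy.
  rewrite min_l ?exprn_ile1//; apply: le_trans (HC _ _ xM xy) _.
  by rewrite ler_wpM2r ?sqr_ge0// lerDl.
rewrite min_r ?exprn_ege1 ?(ltW xy)// mulr1.
have /andP[a0 a1] := cutoff_sqr01 x; have /andP[b0 b1] := cutoff_sqr01 y.
have /andP[d0 d1] := cutoff_sqr01 (x *+ 2 - y).
by rewrite mulr2n ler_norml; lra.
Qed.

(** Lipschitz bound for near points, the bound 1 for far ones, and zero when both lie outside the
    cube; the form is the one that [phiB] requires. *)
Lemma cutoff_diff_sqr_le x y : (phi x - phi y) ^+ 2 <=
  (3 * n%:R) ^+ 2 * sqmin r (x - y) * (\1_(cube x0 r) x + \1_(cube x0 r) y).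
Proof.
have n1 : 1 <= n%:R :> R by rewrite ler1n.
have out z : z \notin cube x0 r -> phi z = 0.
  by move=> zB; apply/eqP; apply: contraNT zB => /(cutoff_neq0 r0) H; rewrite inE.
have [ab|] := boolP ((x \in cube x0 r) || (y \in cube x0 r)); last first.
  rewrite negb_or => /andP[/out -> /out ->]; rewrite subrr expr0n /=.
  by rewrite !mulr_ge0 ?sqmin_ge0 ?addr_ge0.
apply: (@le_trans _ _ ((3 * n%:R) ^+ 2 * sqmin r (x - y))); last first.
  rewrite ler_peMr ?mulr_ge0 ?sqmin_ge0 ?sqr_ge0// !indicE.
  by case/orP: ab => ->; rewrite ?lerDl ?lerDr.
rewrite -real_normK ?num_real//.
rewrite /sqmin /Num.min; case: ifP => _.
  rewrite -expr_div_n -exprMn lerXn2r ?nnegrE//; last exact: cutoff_lip.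
  by rewrite !mulr_ge0// invr_ge0 ltW.
rewrite mulr1 lerXn2r ?nnegrE ?mulr_ge0//.
by apply: (le_trans (cutoff_dist_le1 _ _ _ _)); lra.
Qed.

Variables (Omega : set rV) (M : R).
Hypothesis OM : forall x, Omega x -> `|x0 - x| <= M.

Let CJ_ex : exists2 CJ : R, 0 <= CJ & forall x : rV,
  (\int[leb]_y (sqmin 1 (x - y) * kern s (x - y))%:E <= CJ%:E)%E.
Proof.
have [C C0 HC] := @integral_sqmin_kern R n s n2 s0 s1.
by exists (C * 1 `^ (- (2 * s))) => [|x]; [rewrite mulr_ge0 ?powR_ge0|exact: HC].
Qed.

Lemma frac_lap_cutoff : exists2 C : R, 0 < C & forall x, Omega x ->
  [/\ frac_lap_exists s psi x,
      frac_lap_trunc s psi x e @[e --> 0^'+] --> frac_lap s psi x,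
      `|frac_lap s psi x| <= C &
      forall e, 0 < e -> `|frac_lap_trunc s psi x e| <= C].
Proof.
have [C C0 HC] := cutoff_sqr_second_diff_sqmin M.
have [CJ CJ0 HCJ] := CJ_ex.
have mpsi : measurable_fun setT psi.
  by apply: continuous_measurable_rV; exact: continuous_cutoff_sqr.
have le1 : C * CJ <= C * CJ + 1 by rewrite lerDl.
(* [Xs] asks for a positive bound, while [C * CJ] is only known to be nonnegative. *)
exists (C * CJ + 1); first by rewrite ltr_wpDl// mulr_ge0.
move=> x /OM xM; have H y := HC x y xM; split.
- exact: (frac_lap_exists_test s0 mpsi cutoff_sqr01 C0 H (HCJ x)).
- exact: (frac_lap_trunc_cvg s0 mpsi cutoff_sqr01 C0 H (HCJ x)).
- exact: (le_trans (frac_lap_bound s0 mpsi cutoff_sqr01 C0 H (HCJ x))).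
- move=> e e0.
  exact: (le_trans (frac_lap_trunc_bound s0 mpsi cutoff_sqr01 C0 H (HCJ x) e0)).
Qed.

Hypothesis rO : cube x0 r `<=` Omega.

Lemma Xs_cutoff_sqr : Xs Omega s psi.
Proof.
have [C C0 HC] := frac_lap_cutoff.
split.
- exact: continuous_cutoff_sqr.
- apply: closure_subset => x /= px; apply: rO; apply: (cutoff_neq0 r0).
  by apply: contraNN px; rewrite /psi => /eqP ->; rewrite expr0n.
- by move=> x /HC[].
- by exists C => // x /HC[].
Qed.

Lemma cutoff_out x : ~ Omega x -> psi x = 0.
Proof.
move=> nO; rewrite /psi; apply/eqP; rewrite sqrf_eq0; apply/eqP.
by apply: contra_notP nO => /eqP /(cutoff_neq0 r0) H; exact: rO.
Qed.

End test_function.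

(** * Weak solutions tested with a cutoff *)

Section cutoff_energy.
Context (R : realType) (n : nat) (s : R).
Hypotheses (n2 : (2 <= n)%N) (s0 : 0 < s) (s1 : s < 1).

Local Notation rV := 'rV[R]_n.
Local Notation leb := (lebesgue_rV R n).

(** The inner integral is of order r^(-2 s) uniformly in [x], and the cube has volume (2 r)^n. *)
Lemma integral_cutoff_energy : exists2 K : R, 0 <= K & forall (x0 : rV) r, 0 < r ->
  (\int[leb]_x ((\1_(cube x0 r) x)%:E *
     \int[leb]_y ((3 * n%:R) ^+ 2 * sqmin r (x - y) * kern s (x - y))%:E)
   <= (K * r `^ (n%:R - 2 * s))%:E)%E.
Proof.
have [C C0 HC] := @integral_sqmin_kern R n s n2 s0 s1.
pose L : R := (3 * n%:R) ^+ 2.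
have L0 : 0 <= L by exact: sqr_ge0.
exists (L * C * 2 ^+ n); first by rewrite !mulr_ge0.
move=> x0 r r0.
have mk0 (x y : rV) : 0 <= L * sqmin r (x - y) * kern s (x - y).
  by rewrite !mulr_ge0 ?sqmin_ge0 ?kern_ge0.
have inner (x : rV) : (\int[leb]_y (L * sqmin r (x - y) * kern s (x - y))%:E <=
    (L * (C * r `^ (- (2 * s))))%:E)%E.
  rewrite (eq_integral (fun y : rV => L%:E * (sqmin r (x - y) * kern s (x - y))%:E)%E); last first.
    by move=> y _; rewrite -EFinM mulrA.
  rewrite ge0_integralZl//.
  - by rewrite [leRHS]EFinM; apply: lee_wpmul2l; [rewrite lee_fin|exact: HC].
  - apply/measurable_EFinP; apply: measurable_funM.
      by apply: (measurableT_comp (@measurable_sqmin R n r)); exact: measurable_refl_rV.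
    by apply: (measurableT_comp (measurable_kern _)); exact: measurable_refl_rV.
  - by move=> y _; rewrite lee_fin mulr_ge0 ?sqmin_ge0 ?kern_ge0.
have mI : measurable_fun setT
    (fun x : rV => \int[leb]_y (L * sqmin r (x - y) * kern s (x - y))%:E)%E.
  apply: (measurable_fun_fubini_tonelli_F (m2 := leb)
    (fun z : rV * rV => (L * sqmin r (z.1 - z.2) * kern s (z.1 - z.2))%:E)) => //.
    apply/measurable_EFinP; apply: measurable_funM; last exact: measurable_kern_sub.
    apply: measurable_funM => //.
    by apply: (measurableT_comp (@measurable_sqmin R n r)); exact: measurable_sub_rV.
  by move=> z; rewrite lee_fin; exact: mk0.
have mind : measurable_fun setT (fun x : rV => (\1_(cube x0 r) x)%:E : \bar R).
  by apply/measurable_EFinP; apply: measurable_indic; apply: measurable_cube; exact: ltW.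
apply: (@le_trans _ _ (\int[leb]_x ((L * (C * r `^ (- (2 * s))))%:E * (\1_(cube x0 r) x)%:E))%E).
  apply: ge0_le_integral => //.
  - move=> x _; rewrite mule_ge0 ?lee_fin//; apply: integral_ge0 => y _.
    by rewrite lee_fin mk0.
  - exact: emeasurable_funM.
  - exact: emeasurable_funM.
  - by move=> x _; rewrite muleC; apply: lee_wpmul2r; [rewrite lee_fin|exact: inner].
rewrite ge0_integralZl//; last by rewrite lee_fin !mulr_ge0 ?powR_ge0.
rewrite integral_indic//; last by apply: measurable_cube; exact: ltW.
rewrite setIT [X in (_ * X)%E](lebesgue_cube _ (ltW r0)) -EFinM lee_fin.
rewrite powRD; last by apply/implyP => _; rewrite gt_eqF.
rewrite (powR_mulrn _ (ltW r0)) exprMn le_eqVlt; apply/orP; left; apply/eqP.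
by ring.
Qed.

End cutoff_energy.

Section weak_solution_test.
Context (R : realType) (n : nat) (s : R).
Hypotheses (n2 : (2 <= n)%N) (s0 : 0 < s) (s1 : s < 1).

Local Notation rV := 'rV[R]_n.
Local Notation leb := (lebesgue_rV R n).

Variables (Omega : set rV) (mu f u : rV -> R) (mu1 lambda : R).
Hypothesis Omega_open : open Omega.
Hypothesis mmu : measurable_fun Omega mu.
Hypothesis mu10 : 0 < mu1.
Hypothesis mu_ge : {ae leb, forall x, Omega x -> mu1 <= mu x}.
Hypothesis mf : measurable_fun setT f.
Hypothesis f0 : forall x, 0 <= f x.
Hypothesis lambda0 : 0 < lambda.
Hypothesis u_sol : weak_solution Omega s mu lambda f u.

Variables (x0 : rV) (r M : R).
Hypothesis r0 : 0 < r.
Hypothesis OM : forall x, Omega x -> `|x0 - x| <= M.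
Hypothesis rO : cube x0 r `<=` Omega.

Let phi := cutoff x0 r.
Let psi (x : rV) := cutoff x0 r x ^+ 2.

Let mO : measurable Omega := open_measurable_rV Omega_open.

Let um : measurable_fun setT u. Proof. by have [] := u_sol. Qed.

Let psi0 x : 0 <= psi x. Proof. exact: sqr_ge0. Qed.

Let psi_le1 x : psi x <= 1. Proof. by have /andP[] := cutoff_sqr01 x0 r x. Qed.

Let mpsi : measurable_fun setT psi.
Proof. by apply: measurable_funX; exact: measurable_cutoff. Qed.

Let u_out : {ae leb, forall x, ~ Omega x -> u x = 0}.
Proof. by have [_ _ _] := u_sol. Qed.

Let iu : leb.-integrable setT (EFin \o u).
Proof.
have [_ iuO _ _ _] := u_sol.
apply/integrableP; split; first exact/measurable_EFinP.
have /integrableP[_ fin] := iuO.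
have mau : measurable_fun setT (fun x => `|(u x)%:E|%E).
  by apply/measurable_EFinP; exact: measurableT_comp.
rewrite (@ge0_ae_eq_integral _ _ _ leb setT _ ((fun x => `|(u x)%:E|) \_ Omega)%E)//.
- by rewrite -integral_mkcond.
- by apply/(measurable_restrictT _ mO); exact: measurable_funTS.
- by move=> x _; rewrite patchE; case: ifP.
- apply: filterS u_out => x ux _; rewrite /= patchE; case: ifPn => // /negP xO.
  by rewrite ux ?normr0// => Ox; apply: xO; rewrite inE.
Qed.

Let trunc_le e : 0 < e ->
  (\int[leb]_(x in Omega) (u x * frac_lap_trunc s psi x e)%:E <=
   mu1%:E * \int[leb]_x ((psi x)%:E * Ds2 s u x) +
   (2 * mu1)^-1%:E * \int[leb]_x ((\1_(cube x0 r) x)%:E *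
     \int[leb]_y ((3 * n%:R) ^+ 2 * sqmin r (x - y) * kern s (x - y))%:E))%E.
Proof.
move=> e0.
have phi01 x : 0 <= phi x <= 1 by rewrite /phi cutoff_ge0 cutoff_le1.
have mphi : measurable_fun setT phi by exact: measurable_cutoff.
have mT := @measurable_frac_lap_trunc R n s u um phi e s0 e0 iu mphi phi01.
have <- : (\int[leb]_x (u x * frac_lap_trunc s psi x e)%:E =
    \int[leb]_(x in Omega) (u x * frac_lap_trunc s psi x e)%:E)%E.
  rewrite [RHS]integral_mkcond; apply: ae_eq_integral => //.
    by apply/(measurable_restrictT _ mO); exact: measurable_funTS.
  apply: filterS u_out => x ux _; rewrite /= patchE; case: ifPn => // /negP xO.
  by rewrite ux ?mul0r// => Ox; apply: xO; rewrite inE.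
(* With [mu1] as AM-GM constant, the first term is the lower bound of the nonlinear term of the
   equation. *)
apply: (@energy_le R n s u um phi (fun h => (3 * n%:R) ^+ 2 * sqmin r h)
  (cube x0 r) e mu1) => //.
- by apply: measurable_funM => //; exact: measurable_sqmin.
- by move=> h; rewrite mulr_ge0 ?sqmin_ge0 ?sqr_ge0.
- by move=> h; rewrite sqminN.
- by apply: measurable_cube; exact: ltW.
- by move=> x y; exact: cutoff_diff_sqr_le.
Qed.

(** The bound on the right is free of [e]; along e = 1 / (k + 1) the integrands on the left are
    dominated by C |u|, where C bounds the truncated Laplacians uniformly. *)
Let lap_le :
  (\int[leb]_(x in Omega) (u x * frac_lap s psi x)%:E <=
   mu1%:E * \int[leb]_x ((psi x)%:E * Ds2 s u x) +
   (2 * mu1)^-1%:E * \int[leb]_x ((\1_(cube x0 r) x)%:E *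
     \int[leb]_y ((3 * n%:R) ^+ 2 * sqmin r (x - y) * kern s (x - y))%:E))%E.
Proof.
have [C C0 HC] := frac_lap_cutoff n2 s0 s1 r0 OM.
pose e (k : nat) : R := k.+1%:R^-1.
have e0 k : 0 < e k by rewrite invr_gt0.
have phi01 x : 0 <= phi x <= 1 by rewrite /phi cutoff_ge0 cutoff_le1.
have mphi : measurable_fun setT phi by exact: measurable_cutoff.
have mT k : measurable_fun Omega (fun x => (u x * frac_lap_trunc s psi x (e k))%:E).
  apply: measurable_funTS.
  exact: (@measurable_frac_lap_trunc R n s u um phi (e k) s0 (e0 k) iu mphi phi01).
have cT x : Omega x ->
    (u x * frac_lap_trunc s psi x (e k))%:E @[k --> \oo] --> (u x * frac_lap s psi x)%:E.
  move=> /HC[_ /cvg_at_rightP H _ _]; apply: cvg_EFin; first exact: nearW.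
  apply: cvgM; first exact: cvg_cst.
  by apply: H; split => //; exact: cvg_harmonic.
have iC : leb.-integrable Omega (fun x => (C * `|u x|)%:E).
  apply: (integrableS measurableT) => //.
  apply: (@eq_integrable _ _ _ _ _ measurableT (fun x => C%:E * `|(u x)%:E|)%E) => //.
  by apply: integrableZl => //; exact: (integrable_abse iu).
have cvgI : (\int[leb]_(x in Omega) (u x * frac_lap_trunc s psi x (e k))%:E)%E
    @[k --> \oo] --> (\int[leb]_(x in Omega) (u x * frac_lap s psi x)%:E)%E.
  have bound k x : Omega x ->
      (`|(u x * frac_lap_trunc s psi x (e k))%:E| <= (C * `|u x|)%:E)%E.
    by move=> /HC[_ _ _ H]; rewrite lee_fin normrM mulrC ler_wpM2r//; exact: H.
  have fing x : Omega x -> (C * `|u x|)%:E \is a fin_num by [].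
  apply: (@dominated_cvg _ _ R leb Omega mO
    (fun k x => (u x * frac_lap_trunc s psi x (e k))%:E)
    (fun x => (u x * frac_lap s psi x)%:E) (fun x => (C * `|u x|)%:E)).
  - exact: mT.
  - exact: cT.
  - exact: fing.
  - exact: iC.
  - exact: bound.
rewrite -(cvg_lim (@ereal_hausdorff R) cvgI); apply: lime_le.
  by apply/cvg_ex; eexists; exact: cvgI.
by apply: nearW => k; exact: trunc_le.
Qed.

Let mD : measurable_fun Omega (Ds2 s u).
Proof. by apply: measurable_funTS; exact: measurable_Ds2. Qed.

Let D0 x : (0 <= Ds2 s u x)%E.
Proof. exact: Ds2_ge0. Qed.

Let I2_mkcond : (\int[leb]_x ((psi x)%:E * Ds2 s u x) =
  \int[leb]_(x in Omega) ((psi x)%:E * Ds2 s u x))%E.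
Proof.
rewrite [RHS]integral_mkcond; apply: eq_integral => x _.
rewrite patchE; case: ifPn => // /negP xO.
rewrite /psi (cutoff_out r0 rO) ?mul0e// => Ox; apply: xO; rewrite inE//.
Qed.

(** [psi] is at most 1 and [Ds2 s u] is integrable on [Omega]. Finiteness is what allows this term
    to be cancelled. *)
Let I2_fin : (\int[leb]_(x in Omega) ((psi x)%:E * Ds2 s u x))%E \is a fin_num.
Proof.
have [_ _ iD _ _] := u_sol.
apply: integrable_fin_num => //.
apply: (le_integrable mO _ _ iD).
  by apply: emeasurable_funM => //; apply/measurable_EFinP; exact: measurable_funTS.
move=> x _; rewrite abseM [leRHS]gee0_abs//= [`|psi x|]ger0_norm// gee0_abs//.
by rewrite -[leRHS]mul1e lee_wpmul2r// lee_fin.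
Qed.

Lemma weak_solution_test_le :
  (lambda%:E * \int[leb]_(x in Omega) (f x * psi x)%:E <=
   (2 * mu1)^-1%:E * \int[leb]_x ((\1_(cube x0 r) x)%:E *
     \int[leb]_y ((3 * n%:R) ^+ 2 * sqmin r (x - y) * kern s (x - y))%:E))%E.
Proof.
have [_ _ _ _ /(_ _ (Xs_cutoff_sqr n2 s0 s1 r0 OM rO)) Hw] := u_sol.
have mpO : measurable_fun Omega (fun x => (psi x)%:E).
  by apply/measurable_EFinP; exact: measurable_funTS.
have mlf : measurable_fun Omega (fun x => (lambda * f x)%:E).
  by apply/measurable_EFinP; apply: measurable_funM => //; exact: measurable_funTS.
(* mu is bounded below only almost everywhere, whereas comparing integrals needs
   integrands that are nonnegative everywhere. *)
pose mu' x := Num.max (mu x) mu1.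
have mmu' : measurable_fun Omega (fun x => (mu' x)%:E).
  by apply/measurable_EFinP; exact: measurable_maxr.
have mmuE : measurable_fun Omega (fun x => (mu x)%:E) by exact/measurable_EFinP.
have m'ge x : mu1 <= mu' x by rewrite le_max lexx orbT.
have m'0 x : 0 <= mu' x by rewrite (le_trans (ltW mu10)).
have lf0 x : (0 <= (lambda * f x)%:E)%E by rewrite lee_fin mulr_ge0// ltW.
have mG (g : rV -> R) : measurable_fun Omega (fun x => (g x)%:E) -> measurable_fun Omega
    (fun x => ((g x)%:E * Ds2 s u x + (lambda * f x)%:E) * (psi x)%:E)%E.
  move=> mg; apply: emeasurable_funM => //; apply: emeasurable_funD => //.
  exact: emeasurable_funM.
have rhs_ge : (\int[leb]_(x in Omega) ((mu1%:E * Ds2 s u x + (lambda * f x)%:E) * (psi x)%:E) <=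
    \int[leb]_(x in Omega) (((mu x)%:E * Ds2 s u x + (lambda * f x)%:E) * (psi x)%:E))%E.
  rewrite [leRHS](_ : _ = \int[leb]_(x in Omega)
      (((mu' x)%:E * Ds2 s u x + (lambda * f x)%:E) * (psi x)%:E))%E; last first.
    apply: ae_eq_integral => //; [exact: mG|exact: mG|].
    apply: filterS mu_ge => x mux Ox; rewrite /mu' max_l//; exact: mux.
  apply: ge0_le_integral => //.
  - move=> x _; rewrite mule_ge0 ?adde_ge0 ?mule_ge0 ?lee_fin ?(ltW mu10)//.
    by rewrite mulr_ge0// ltW.
  - exact: (mG (fun=> mu1)).
  - exact: mG.
  - move=> x _; apply: lee_wpmul2r; first by rewrite lee_fin.
    by rewrite leeD2r// lee_wpmul2r// lee_fin.
have split_rhs : (\int[leb]_(x in Omega) ((mu1%:E * Ds2 s u x + (lambda * f x)%:E) * (psi x)%:E)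
    = mu1%:E * \int[leb]_(x in Omega) ((psi x)%:E * Ds2 s u x) +
      lambda%:E * \int[leb]_(x in Omega) (f x * psi x)%:E)%E.
  have mpD : measurable_fun Omega (fun x => (psi x)%:E * Ds2 s u x)%E.
    exact: emeasurable_funM.
  have mfp : measurable_fun Omega (fun x => (f x * psi x)%:E).
    by apply/measurable_EFinP; apply: measurable_funM; exact: measurable_funTS.
  have pD0 x : (0 <= (psi x)%:E * Ds2 s u x)%E by rewrite mule_ge0// lee_fin.
  have fp0 x : (0 <= (f x * psi x)%:E)%E by rewrite lee_fin mulr_ge0.
  rewrite -ge0_integralZl// ?lee_fin ?(ltW mu10)//.
  rewrite -ge0_integralZl// ?lee_fin ?(ltW lambda0)//.
  rewrite -ge0_integralD//; last 4 first.
  - by move=> x _; apply: mule_ge0; [rewrite lee_fin ltW|exact: pD0].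
  - exact: emeasurable_funM.
  - by move=> x _; apply: mule_ge0; [rewrite lee_fin ltW|exact: fp0].
  - exact: emeasurable_funM.
  apply: eq_integral => x _.
  rewrite ge0_muleDl ?mule_ge0 ?lee_fin ?(ltW mu10)//.
    by rewrite -muleA [(Ds2 s u x * _)%E]muleC -EFinM -mulrA.
  by rewrite mulr_ge0// ltW.
(* With I the integral of [psi] times [Ds2 s u]: mu1 I plus the term in [f] is at most the
   right-hand side of the equation, hence at most mu1 I plus the energy; mu1 I cancels. *)
have := lap_le; rewrite I2_mkcond Hw => /(le_trans rhs_ge); rewrite split_rhs.
by rewrite leeD2lE// fin_numM.
Qed.

End weak_solution_test.

(** * The singular right-hand side *)

Section singular_power.
Context (R : realType) (n : nat).

Local Notation rV := 'rV[R]_n.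
Local Notation leb := (lebesgue_rV R n).

Lemma measurable_dist_powR (x0 : rV) (a : R) :
  measurable_fun setT (fun x : rV => `|x0 - x| `^ a).
Proof.
by apply: (measurableT_comp (measurable_powR _)); exact: measurable_norm_sub.
Qed.

(** The p-th power is |x0 - x|^(-p q), integrable on a cube of radius [M] around [x0], which
    contains [Omega]. *)
Lemma Lp_on_dist_powRN (Omega : set rV) (x0 : rV) (M p q : R) : measurable Omega ->
  (forall x, Omega x -> `|x0 - x| <= M) -> 0 < M -> 1 <= p -> 0 <= q -> p * q < n%:R ->
  Lp_on Omega p%:E (fun x => `|x0 - x| `^ (- q)).
Proof.
move=> mO OM M0 p1 q0 pq.
have p0 : 0 <= p by rewrite (le_trans ler01).
have mf := measurable_dist_powR x0 (- q).
set f := (fun x : rV => _) in mf *.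
have mfO : measurable_fun setT (f \_ Omega).
  by apply/(measurable_restrictT _ mO); exact: measurable_funTS.
have [C C0 HC] := @integral_cube_powR R n (p * q) (mulr_ge0 p0 q0) pq.
rewrite /Lp_on; apply/andP; split; rewrite inE//=.
rewrite /finite_norm unlock /=; apply: poweR_lty.
apply: (le_lt_trans _ (ltry (C * M `^ (n%:R - p * q)))).
apply: (le_trans _ (HC x0 M M0)).
apply: ge0_le_integral => //.
- rewrite (_ : (fun x => _) = (fun x => (`|(f \_ Omega) x| `^ p)%:E))//.
  apply/measurable_EFinP; apply: (measurableT_comp (measurable_powR _)).
  exact: measurableT_comp.
- apply/measurable_EFinP; apply: measurable_funM; last exact: measurable_dist_powR.
  by apply: measurable_indic; apply: measurable_cube; exact: ltW.
- move=> x _; rewrite -[leLHS]/((`|(f \_ Omega) x| `^ p)%:E) lee_fin patchE.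
  case: ifPn => [xO|_].
    rewrite indicE (_ : x \in cube x0 M = true) ?mul1r; last first.
      by apply: mem_set; apply: OM; exact: set_mem xO.
    rewrite (ger0_norm (powR_ge0 _ _)) /f -powRrM.
    by rewrite mulNr mulrC.
  rewrite normr0 powR0 ?mulr_ge0 ?powR_ge0// gt_eqF//.
  by rewrite (lt_le_trans ltr01).
Qed.

(** On the cube of radius r / (2 n), of volume (r / n)^n, the singular power is at least r^(-q) off
    the centre and the squared cutoff is at least 1/4. *)
Lemma integral_dist_powRN_cutoff_ge (Omega : set rV) (x0 : rV) (r q : R) :
  (0 < n)%N -> measurable Omega -> 0 < r -> cube x0 r `<=` Omega -> 0 <= q ->
  ((r `^ (- q) / 4 * (r / n%:R) ^+ n)%:E <=
   \int[leb]_(x in Omega) (`|x0 - x| `^ (- q) * cutoff x0 r x ^+ 2)%:E)%E.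
Proof.
move=> n0 mO r0 rO q0.
have n1 : 1 <= n%:R :> R by rewrite ler1n.
pose rho := r / (2 * n%:R).
have rho0 : 0 < rho by rewrite divr_gt0// mulr_gt0// (lt_le_trans ltr01).
have rho_le : rho <= r.
  have d0 : 0 < 2 * n%:R :> R by lra.
  by rewrite /rho ler_pdivrMr// ler_peMr ?(ltW r0)//; lra.
have rhoE : 2 * rho = r / n%:R.
  by rewrite /rho; field; rewrite gt_eqF// (lt_le_trans ltr01).
have mc := measurable_cube x0 (ltW rho0).
have k0 : 0 <= r `^ (- q) / 4 by rewrite divr_ge0 ?powR_ge0.
have mind : measurable_fun Omega (fun x : rV => (\1_(cube x0 rho) x)%:E : \bar R).
  by apply/measurable_EFinP; exact: measurable_indic.
have -> : ((r `^ (- q) / 4 * (r / n%:R) ^+ n)%:E =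
   \int[leb]_(x in Omega) ((r `^ (- q) / 4)%:E * (\1_(cube x0 rho) x)%:E))%E.
  rewrite ge0_integralZl ?lee_fin//.
  rewrite integral_indic// setIidl; last first.
    by move=> x xr; apply: rO; exact: le_trans rho_le.
  by rewrite [X in (_ * X)%E](lebesgue_cube _ (ltW rho0)) rhoE EFinM.
apply: ae_ge0_le_integral => //.
- by move=> x _; rewrite -EFinM lee_fin mulr_ge0.
- exact: emeasurable_funM.
- by move=> x _; rewrite lee_fin mulr_ge0 ?powR_ge0 ?sqr_ge0.
- apply/measurable_EFinP; apply: measurable_funM; apply: measurable_funTS.
    exact: measurable_dist_powR.
  by apply: measurable_funX; apply: continuous_measurable_rV; exact: continuous_cutoff.
(* The centre is discarded: there 0 `^ (- q) = 0 when q > 0. *)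
- exists (cube x0 0); split.
  + exact: measurable_cube.
  + by rewrite [LHS]lebesgue_cube// mulr0 expr0n (gtn_eqF n0).
  + move=> x /=; apply: contra_notP => xx0 Ox.
    have {}xx0 : 0 < `|x0 - x|.
      by rewrite ltNge; apply/negP => H; apply: xx0.
    rewrite -EFinM lee_fin indicE; case: (boolP (x \in _)) => [|_]; last first.
      by rewrite mulr0 mulr_ge0 ?powR_ge0 ?sqr_ge0.
    rewrite inE mulr1 => xr; rewrite ler_pM ?powR_ge0//.
      by rewrite ler_powRN// (le_trans xr).
    have := cutoff_ge_half n0 r0 xr; nra.
Qed.

End singular_power.

Lemma powR_lt_exists (R : realType) (A B a r1 : R) : 0 < A -> 0 <= B -> 0 < a -> 0 < r1 ->
  exists r, [/\ 0 < r, r <= r1 & B * r `^ a < A].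
Proof.
move=> A0 B0 a0 r10; have B1 : 0 < B + 1 by lra.
have AB : 0 < A / (B + 1) by rewrite divr_gt0.
(* [t] solves (B + 1) t^a = A; the added 1 admits [B = 0] and makes the inequality strict. *)
pose t := (A / (B + 1)) `^ a^-1.
have t0 : 0 < t by rewrite powR_gt0.
exists (Num.min r1 t); split; first by rewrite lt_min r10.
  by rewrite ge_min lexx.
apply: (@le_lt_trans _ _ (B * (A / (B + 1)))).
  rewrite ler_wpM2l//.
  have <- : t `^ a = A / (B + 1).
    by rewrite /t -powRrM mulVf ?gt_eqF// powRr1// ltW.
  rewrite ge0_ler_powR ?(ltW a0) ?nnegrE ?le_min ?(ltW r10) ?(ltW t0)//.
  by rewrite ge_min lexx orbT.
by rewrite mulrA ltr_pdivrMr// mulrC ltr_pM2l//; lra.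
Qed.

Theorem theorem1p3 (R : realType) (N : nat) (Omega : set 'rV[R]_N) (s : R)
    (mu : 'rV[R]_N -> R) (mu1 : R)
    (N_ge2 : (2 <= N)%N)
    (Omega_domain : is_domain Omega)
    (Omega_bounded : bounded_set Omega)
    (Omega_C2 : Ck_boundary 2 Omega)
    (s_gt0 : 0 < s) (s_lt1 : s < 1)
    (mu_Loo : Lp_on Omega +oo%E mu)
    (mu1_gt0 : 0 < mu1)
    (mu_ge : {ae lebesgue_rV R N, forall x, Omega x -> mu1 <= mu x}) :
  forall p : R, 1 <= p -> p < N%:R / (2 * s) ->
  exists f : 'rV[R]_N -> R,
    Lp_on Omega p%:E f /\
    forall lambda : R, 0 < lambda ->
      ~ exists u : 'rV[R]_N -> R,
          W0sp Omega s 2 u /\ weak_solution Omega s mu lambda f u.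
Proof.
move=> p p1 pN.
have p0 : 0 < p by rewrite (lt_le_trans ltr01).
have [Oopen _ [x0 Ox0]] := Omega_domain.
have n0 : (0 < N)%N by exact: leq_trans N_ge2.
have n1 : 1 <= N%:R :> R by rewrite ler1n.
have [M [M0 OM]] : exists M : R, 0 < M /\ forall x, Omega x -> `|x0 - x| <= M.
  have [M0 [_ HM]] := Omega_bounded.
  exists (`|x0| + (`|M0| + 1)); split.
    by rewrite ltr_wpDl// ltr_wpDl.
  move=> x Ox; apply: (le_trans (ler_normB _ _)); rewrite lerD2l.
  by apply: HM => //; rewrite (le_lt_trans (ler_norm _))// ltrDl.
have [r1 r10 r1O] : exists2 r1 : R, 0 < r1 & forall r, r <= r1 -> cube x0 r `<=` Omega.
  have : nbhs x0 Omega by apply: open_nbhs_nbhs.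
  move=> /nbhs_ballP[e /= e0 eO]; exists (e / 2); first by rewrite divr_gt0.
  move=> r re y yr; apply: eO; rewrite -ball_normE /=.
  by apply: (le_lt_trans yr); lra.
have mO := open_measurable_rV Oopen.
have sp : 2 * s < N%:R / p.
  by rewrite ltr_pdivlMr// mulrC -ltr_pdivlMr// mulr_gt0.
(* The midpoint of the interval from 2 s to N / p, nonempty because p < N / (2 s). *)
pose q := (2 * s + N%:R / p) / 2.
have qs : 2 * s < q by rewrite /q; lra.
have q0 : 0 <= q by rewrite (le_trans _ (ltW qs))// mulr_ge0// ltW.
have pq : p * q < N%:R.
  by rewrite mulrC -ltr_pdivlMr// /q; lra.
exists (fun x => `|x0 - x| `^ (- q)); split.
  exact: (Lp_on_dist_powRN mO OM M0 p1 q0 pq).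
move=> lambda lambda0 [u [_ u_sol]].
have mmu : measurable_fun Omega mu.
  apply/(measurable_restrictT _ mO).
  by move: mu_Loo; rewrite /Lp_on => /andP[]; rewrite inE.
have [K K0 HK] := integral_cutoff_energy N_ge2 s_gt0 s_lt1.
(* [A] and [B] are the coefficients of the lower and the upper bound: divided by r^(N - q), the
   tested inequality reads A <= B r^(q - 2 s). *)
pose A := lambda / (4 * N%:R ^+ N).
have A0 : 0 < A by rewrite divr_gt0// mulr_gt0// exprn_gt0// (lt_le_trans ltr01).
pose B := (2 * mu1)^-1 * K.
have c0 : 0 <= (2 * mu1)^-1 by rewrite invr_ge0 mulr_ge0// ltW.
have B0 : 0 <= B by rewrite mulr_ge0.
have qs0 : 0 < q - 2 * s by rewrite subr_gt0.
(* Only the radius depends on [lambda]; the right-hand side was fixed before. *)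
have [r [r0 rr1 rAB]] := powR_lt_exists A0 B0 qs0 r10.
have rO := r1O r rr1.
have := weak_solution_test_le N_ge2 s_gt0 s_lt1 Oopen mmu mu1_gt0 mu_ge
  (measurable_dist_powR x0 (- q)) (fun x => powR_ge0 _ _) lambda0 u_sol r0 OM rO.
have c0' : (0 <= ((2 * mu1)^-1)%:E)%E by rewrite lee_fin.
move=> /le_trans /(_ (lee_wpmul2l c0' (HK x0 r r0))).
have l0' : (0 <= lambda%:E)%E by rewrite lee_fin ltW.
move=> /(le_trans (lee_wpmul2l l0' (integral_dist_powRN_cutoff_ge n0 mO r0 rO q0))).
rewrite -!EFinM lee_fin; apply/negP; rewrite -ltNge.
have -> : (2 * mu1)^-1 * (K * r `^ (N%:R - 2 * s)) =
    B * r `^ (q - 2 * s) * (r `^ (- q) * r ^+ N).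
  rewrite -powR_mulrn ?(ltW r0)// -powRD; last by apply/implyP => _; rewrite gt_eqF.
  rewrite -[RHS]mulrA -powRD; last by apply/implyP => _; rewrite gt_eqF.
  by rewrite /B -mulrA; congr (_ * (_ * _ `^ _)); ring.
have -> : lambda * (r `^ (- q) / 4 * (r / N%:R) ^+ N) = A * (r `^ (- q) * r ^+ N).
  rewrite /A expr_div_n; field.
  by rewrite expf_neq0// gt_eqF// (lt_le_trans ltr01).
by rewrite ltr_pM2r// mulr_gt0 ?powR_gt0 ?exprn_gt0.
Qed.
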